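(* Let $a>0$, $\gamma\in\mathbb{R}$, $\alpha>0$, $\mu>\max\left\{\frac{\gamma}{\alpha},0\right\}$, and for $x>0$ let $\widetilde g(x,a,\gamma,\alpha,\mu)=\sum_{k=0}^{\infty}\frac{(-1)^k(k+a)^{\gamma}}{(x(k+a)^{\alpha}+1)^{\mu}}$. Then $$\widetilde g(x,a,\gamma,\alpha,\mu)\underset{x\to+0}{\sim}\sum_{k=0}^{\infty}\frac{(-1)^k}{k!}\,\frac{\Gamma(\mu+k)}{\Gamma(\mu)}\,\widetilde\zeta(-\alpha k-\gamma,a)\,x^k .$$
   Context: The series defining $\widetilde g$ is understood as the limit of its partial sums (it may converge only conditionally). $\Gamma$ is the Euler gamma function. For fixed $a>0$, $\widetilde\zeta(s,a)$ is defined by $\widetilde\zeta(s,a)=\sum_{k=0}^{\infty}\frac{(-1)^k}{(k+a)^s}$ for $\operatorname{Re}s>0$ and is continued analytically to all of $\mathbb{C}$ (for $\operatorname{Re}s>1$, $\widetilde\zeta(s,a)=\zeta(s,a)-2^{1-s}\zeta\left(s,\frac{a+1}{2}\right)$, where $\zeta(s,a)$ is the Hurwitz zeta function). Meaning of the asymptotic expansion: $F(x)\underset{x\to+0}{\sim}\sum_{k=0}^\infty c_kx^k$ means that for every integer $N\ge0$ one has $F(x)-\sum_{k=0}^{N}c_kx^k=o(x^N)$ as $x\to+0$. *)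

(* Defs.v *)
From Stdlib Require Import Reals ClassicalEpsilon.
From Coquelicot Require Import Coquelicot.
Open Scope R_scope.

(* Only meant for [z > 0], where the improper integral converges. *)
Definition Gamma (z : R) : R :=
  RInt_gen (fun t => Rpower t (z - 1) * exp (- t))
    (at_right 0) (Rbar_locally p_infty).

(* [Series] is the limit of the partial sums; the convergence may be only
   conditional. *)
Definition alt_g (x a gam alpha mu : R) : R :=
  Series (fun k : nat =>
    (-1) ^ k * Rpower (INR k + a) gam
      / Rpower (x * Rpower (INR k + a) alpha + 1) mu).

Definition Cexp (z : C) : C :=
  (exp (Re z) * cos (Im z), exp (Re z) * sin (Im z)).

(* [x ^ s] for [x > 0], with the real logarithm of [x]. *)
Definition Cpower (x : R) (s : C) : C := Cexp (s * RtoC (ln x))%C.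

Definition entire (f : C -> C) : Prop :=
  forall s0 : C, exists (c : nat -> C) (r : posreal),
    forall s : C, Cmod (s - s0)%C < r ->
      is_pseries (K := C_AbsRing) (V := C_NormedModule) c (s - s0)%C (f s).

Definition is_alt_zeta (a : R) (Z : C -> C) : Prop :=
  entire Z /\
  forall s : C, 0 < Re s ->
    is_series (K := C_AbsRing) (V := C_NormedModule)
      (fun k : nat => (RtoC ((-1) ^ k) / Cpower (INR k + a) s)%C) (Z s).

(* For [a > 0] there is exactly one function satisfying [is_alt_zeta a]: the
   analytic continuation of the series to the whole plane. *)
Definition alt_zeta (a : R) : C -> C :=
  epsilon (inhabits (fun _ : C => RtoC 0)) (is_alt_zeta a).

(* The expansion is stated in [C] because the values of [alt_zeta] are complex
   numbers. [is_domin F f g] reads "g is o(f) along the filter F". *)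
Definition asymp_expansion (F : R -> C) (c : nat -> C) : Prop :=
  forall N : nat,
    is_domin (Ku := R_AbsRing) (Kv := C_AbsRing)
      (U := R_NormedModule) (V := C_NormedModule)
      (at_right 0)
      (fun x : R => x ^ N)
      (fun x : R =>
        (F x - sum_n (G := C_AbelianMonoid)
                 (fun k : nat => c k * RtoC (x ^ k)) N)%C).

(* Main.v *)
Require Import Defs.
From Stdlib Require Import Reals Factorial Lra Lia ClassicalEpsilon Classical.
From Coquelicot Require Import Coquelicot.
Open Scope R_scope.

(** Since [2 * sum (-1)^k u_k - u_0 = sum (-1)^k (u_k - u_(k+1))], an alternating
    series can be summed after differencing its terms, and iterating extends the
    sum linearly to terms of polynomial growth: each difference of a symbol of
    order [p] in [t = k + a] has order [p - 1], so enough differences give an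
    absolutely convergent series, whose sum is bounded by the seminorms of the
    symbol.

    The extended sum of [(k+a)^(-s)] continues the alternating zeta function:
    applied to the Taylor remainders of [z |-> (k+a)^(-s0-z)], which are symbols
    of a fixed order with geometrically decaying seminorms, the bound gives a
    power series around every [s0], and the identity theorem on the real axis
    shows that every continuation has the same values there.

    For [g], applied to [(k+a)^gam * R(x (k+a)^alpha)] with [R] the binomial Taylor
    remainder of [(1+u)^(-mu)] of order [N + 1], it gives [O(x^(N+1))]: all
    derivatives of [R(x t^alpha)] obey symbol bounds of order [alpha (N+1)] with a
    factor [x^(N+1)], because [u R'] is a combination of such remainders. *)

(** * Euler summation *)

(* Iterates the identity
   [2 * sum (-1)^k u_k - u_0 = sum (-1)^k (u_k - u_(k+1))]. *)
Fixpoint euler_level (m : nat) (u : nat -> R) (l : R) : Prop :=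
  match m with
  | O => is_series (fun k => (-1) ^ k * u k) l
  | S m' => euler_level m' (fun k => u k - u (S k)) (2 * l - u O)
  end.

(** The level is left free: raising it keeps the value, so sums obtained at different levels can be
    added and compared. *)
Definition euler_sum (u : nat -> R) (l : R) : Prop :=
  exists m, euler_level m u l.

Lemma euler_level_ext m (u v : nat -> R) l :
  (forall k, u k = v k) -> euler_level m u l -> euler_level m v l.
Proof.
  revert u v l; induction m as [|m IH]; simpl; intros u v l Huv.
  - apply is_series_ext; intros k; now rewrite Huv.
  - rewrite <- (Huv O); apply IH; intros k; now rewrite !Huv.
Qed.

(** The differenced series is the original one plus its signed terms from index [1] on, and the
    latter sum to [l - u O]. *)
Lemma euler_level_S m u l : euler_level m u l -> euler_level (S m) u l.
Proof.
  revert u l; induction m as [|m IH]; intros u l.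
  - simpl; intros H.
    assert (H1 : is_series (fun k => (-1) ^ S k * u (S k)) (l - u O)).
    { apply (is_series_incr_1 (fun k => (-1) ^ k * u k)).
      replace (plus _ _) with l; [easy|].
      unfold plus; simpl; ring. }
    replace (2 * l - u O) with (plus l (l - u O)) by (unfold plus; simpl; ring).
    refine (is_series_ext _ _ _ _ (is_series_plus _ _ _ _ H H1)).
    intros k; unfold plus; simpl; ring.
  - intros H; exact (IH _ _ H).
Qed.

Lemma euler_level_le m n u l :
  (m <= n)%nat -> euler_level m u l -> euler_level n u l.
Proof.
  induction 1 as [|n _ IH]; [easy|].
  intros H; apply euler_level_S; auto.
Qed.

Lemma euler_level_plus m u v l l' :
  euler_level m u l -> euler_level m v l' ->
  euler_level m (fun k => u k + v k) (l + l').
Proof.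
  revert u v l l'; induction m as [|m IH]; simpl; intros u v l l' H H'.
  - refine (is_series_ext _ _ _ _ (is_series_plus _ _ _ _ H H')).
    intros k; unfold plus; simpl; ring.
  - replace (2 * (l + l') - _) with (2 * l - u O + (2 * l' - v O)) by ring.
    refine (euler_level_ext _ _ _ _ _ (IH _ _ _ _ H H')).
    intros k; ring.
Qed.

Lemma euler_level_scal m c u l :
  euler_level m u l -> euler_level m (fun k => c * u k) (c * l).
Proof.
  revert u l; induction m as [|m IH]; simpl; intros u l H.
  - refine (is_series_ext _ _ _ _ (is_series_scal c _ _ H)).
    intros k; unfold scal; simpl; unfold mult; simpl; ring.
  - replace (2 * (c * l) - _) with (c * (2 * l - u O)) by ring.
    refine (euler_level_ext _ _ _ _ _ (IH _ _ H)).
    intros k; ring.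
Qed.

Lemma euler_level_unique m u l l' :
  euler_level m u l -> euler_level m u l' -> l = l'.
Proof.
  revert u l l'; induction m as [|m IH]; simpl; intros u l l' H H'.
  - apply is_series_unique in H, H'; congruence.
  - specialize (IH _ _ _ H H'); lra.
Qed.

Lemma euler_sum_unique u l l' : euler_sum u l -> euler_sum u l' -> l = l'.
Proof.
  intros [m H] [n H'].
  apply (euler_level_unique (m + n) u).
  - apply (euler_level_le m); [lia|easy].
  - apply (euler_level_le n); [lia|easy].
Qed.

Lemma euler_sum_plus u v l l' :
  euler_sum u l -> euler_sum v l' -> euler_sum (fun k => u k + v k) (l + l').
Proof.
  intros [m H] [n H']; exists (m + n)%nat.
  apply euler_level_plus.
  - apply (euler_level_le m); [lia|easy].
  - apply (euler_level_le n); [lia|easy].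
Qed.

Lemma euler_sum_scal c u l :
  euler_sum u l -> euler_sum (fun k => c * u k) (c * l).
Proof.
  intros [m H]; exists m; now apply euler_level_scal.
Qed.

Lemma euler_sum_ext (u v : nat -> R) l :
  (forall k, u k = v k) -> euler_sum u l -> euler_sum v l.
Proof.
  intros Huv [m H]; exists m; now apply (euler_level_ext _ u).
Qed.

Lemma euler_sum_minus u v l l' :
  euler_sum u l -> euler_sum v l' -> euler_sum (fun k => u k - v k) (l - l').
Proof.
  intros H H'.
  replace (l - l') with (l + (-1) * l') by ring.
  refine (euler_sum_ext _ _ _ _ (euler_sum_plus _ _ _ _ H (euler_sum_scal (-1) _ _ H'))).
  intros k; ring.
Qed.

Lemma sum_n_alt_diff (u : nat -> R) n :
  sum_n (fun k => (-1) ^ k * (u k - u (S k))) n =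
  2 * sum_n (fun k => (-1) ^ k * u k) n - u O - (-1) ^ n * u (S n).
Proof.
  induction n as [|n IH].
  - rewrite !sum_O; simpl; ring.
  - rewrite !sum_Sn, IH; unfold plus; simpl; ring.
Qed.

(* For null sequences nothing new becomes summable: the extra term in the
   partial sums of the differenced series is [(-1)^n u_(n+1)]. *)
Lemma euler_level_series m u l :
  is_lim_seq u 0 -> euler_level m u l ->
  is_series (fun k => (-1) ^ k * u k) l.
Proof.
  revert u l; induction m as [|m IH]; intros u l Hu; simpl; [easy|].
  intros H.
  pose proof (proj1 (is_lim_seq_incr_1 u 0) Hu) as HuS.
  apply IH in H.
  2:{ replace (Finite 0) with (Finite (0 - 0)) by (f_equal; ring).
      now apply is_lim_seq_minus'. }
  assert (Hz : is_lim_seq (fun n => (-1) ^ n * u (S n)) 0).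
  { apply is_lim_seq_abs_0.
    apply is_lim_seq_ext with (fun n => Rabs (u (S n))).
    - intros n; now rewrite Rabs_mult, pow_1_abs, Rmult_1_l.
    - now apply -> is_lim_seq_abs_0. }
  change (is_lim_seq (sum_n (fun k => (-1) ^ k * (u k - u (S k)))) (2 * l - u O)) in H.
  change (is_lim_seq (sum_n (fun k => (-1) ^ k * u k)) l).
  replace (Finite l) with (Finite (/ 2 * (2 * l - u O + 0 + u O)))
    by (f_equal; field).
  eapply is_lim_seq_ext;
    [|apply (is_lim_seq_scal_l _ (/2) _
        (is_lim_seq_plus' _ _ _ _ (is_lim_seq_plus' _ _ _ _ H Hz)
           (is_lim_seq_const (u O))))].
  intros n; cbv beta; rewrite sum_n_alt_diff; field.
Qed.

Lemma euler_sum_series u l :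
  is_lim_seq u 0 -> euler_sum u l -> is_series (fun k => (-1) ^ k * u k) l.
Proof.
  intros Hu [m H]; now apply (euler_level_series m).
Qed.

(** * Symbols and their alternating sums *)

(** Meant for mean value points in [[t, t + 1]]: there [u / t] lies between [1] and [1 + 1/a], so
    moving the base back to [t] costs a constant independent of [t]. *)
Lemma Rpower_ratio_bound a t u p :
  0 < a -> a <= t -> t <= u <= t + 1 ->
  Rpower u p <= Rpower (1 + / a) (Rabs p) * Rpower t p.
Proof.
  intros ha hat hu; unfold Rpower; rewrite <- exp_plus.
  assert (hln : 0 <= ln u - ln t <= ln (1 + / a)).
  { rewrite <- ln_div by lra; split.
    - rewrite <- ln_1; apply ln_le; [lra|].
      apply Rle_div_r; lra.
    - apply ln_le; [apply Rdiv_lt_0_compat; lra|].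
      apply Rle_div_l; [lra|].
      rewrite Rmult_plus_distr_r.
      assert (1 <= / a * t).
      { apply (Rmult_le_reg_l a); [lra|]; field_simplify; lra. }
      lra. }
  assert (hexp : p * ln u <= Rabs p * ln (1 + / a) + p * ln t).
  { replace (p * ln u) with (p * (ln u - ln t) + p * ln t) by ring.
    apply Rplus_le_compat_r.
    apply Rle_trans with (Rabs p * (ln u - ln t)).
    - apply Rmult_le_compat_r; [lra|apply Rle_abs].
    - apply Rmult_le_compat_l; [apply Rabs_pos|lra]. }
  destruct hexp as [h|h]; [left; now apply exp_increasing|right; now rewrite h].
Qed.

Lemma ex_series_Rpower a p :
  0 < a -> p <= -2 -> ex_series (fun k => Rpower (INR k + a) p).
Proof.
  intros ha hp.
  (* With [t = k + a >= a], the split [t^p = t^(p+2) t^(-2)] bounds the first factor by [a^(p+2)]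
     and the second by [((a+1)/a) (1/t - 1/(t+1))], which telescopes. *)
  set (K := Rpower a (p + 2) * ((a + 1) / a)).
  assert (Hpos : forall k, a <= INR k + a).
  { intros k; pose proof (pos_INR k); lra. }
  assert (Htel : is_series (fun k => / (INR k + a) - / (INR (S k) + a)) (/ a)).
  { assert (Hl : is_lim_seq (fun n => / (INR (S n) + a)) 0).
    { replace (Finite 0) with (Rbar_inv p_infty) by reflexivity.
      apply is_lim_seq_inv; [|easy].
      apply is_lim_seq_le_p_loc with (fun n => INR (S n)).
      - exists O; intros n _; lra.
      - apply (is_lim_seq_incr_1 INR), is_lim_seq_INR. }
    change (is_lim_seq (sum_n (fun k => / (INR k + a) - / (INR (S k) + a))) (/ a)).
    replace (Finite (/ a)) with (Finite (/ a - 0)) by (f_equal; ring).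
    refine (is_lim_seq_ext _ _ _ _ (is_lim_seq_minus' _ _ _ _ (is_lim_seq_const (/ a)) Hl)).
    intros n; induction n as [|n IH].
    - rewrite sum_O; simpl; f_equal; f_equal; ring.
    - rewrite sum_Sn, <- IH; unfold plus; simpl; ring. }
  apply (ex_series_le (K := R_AbsRing) (V := R_CompleteNormedModule) _
           (fun k => K * (/ (INR k + a) - / (INR (S k) + a)))).
  - intros k; specialize (Hpos k); set (t := INR k + a) in *.
    rewrite S_INR; replace (INR k + 1 + a) with (t + 1) by (unfold t; ring).
    unfold norm; simpl; unfold abs; simpl.
    rewrite Rabs_pos_eq by (left; apply exp_pos).
    replace p with (p + 2 + (-2)) at 1 by ring; rewrite Rpower_plus.
    unfold K; rewrite Rmult_assoc.
    apply Rmult_le_compat; try (left; apply exp_pos).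
    + replace (p + 2) with (- - (p + 2)) by ring.
      rewrite !(Rpower_Ropp _ (- (p + 2))).
      apply Rinv_le_contravar; [apply exp_pos|].
      apply Rle_Rpower_l; lra.
    + change (-2) with (- (2)); rewrite Rpower_Ropp.
      replace 2 with (INR 2) by reflexivity.
      rewrite Rpower_pow by lra.
      apply Rminus_le_0.
      replace (_ - _) with ((t - a) / (a * t ^ 2 * (t + 1))) by (field; lra).
      apply Rdiv_le_0_compat; [lra|].
      repeat apply Rmult_lt_0_compat; lra.
  - apply (ex_series_scal K (fun k => / (INR k + a) - / (INR (S k) + a))).
    now exists (/ a).
Qed.

Section Symbols.

Variables (a : R) (ha : 0 < a).
Variable I : Type.
Variable w : I -> R.

(* The symbol classes [S^p] of pseudodifferential calculus on [a, oo), with [m]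
   controlled derivatives; each bound is uniform in [i] up to the weight [w i]. *)
Fixpoint symbol (m : nat) (p : R) (h : I -> R -> R) : Prop :=
  (exists C, forall i t, a <= t -> Rabs (h i t) <= C * w i * Rpower t p) /\
  match m with
  | O => True
  | S m' => exists h' : I -> R -> R,
      (forall i t, a <= t -> is_derive (h i) t (h' i t)) /\
      symbol m' (p - 1) h'
  end.

Lemma symbol_bound m p h :
  symbol m p h ->
  exists C, forall i t, a <= t -> Rabs (h i t) <= C * w i * Rpower t p.
Proof. destruct m; now intros [H _]. Qed.

Lemma symbol_pred m p h : symbol (S m) p h -> symbol m p h.
Proof.
  revert p h; induction m as [|m IH]; intros p h [Hb [h' [Hd Hh']]].
  - now split.
  - split; [easy|]; exists h'; split; [easy|]; now apply IH.
Qed.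

(** Equality is asked for on [t > 0] rather than on [t >= a] because the derivative at [t = a] is
    two-sided. *)
Lemma symbol_ext m p h g :
  (forall i t, 0 < t -> h i t = g i t) -> symbol m p h -> symbol m p g.
Proof.
  intros E H.
  assert (Hb : exists C, forall i t, a <= t -> Rabs (g i t) <= C * w i * Rpower t p).
  { destruct (symbol_bound _ _ _ H) as [C HC]; exists C; intros i t Ht.
    rewrite <- E by lra; auto. }
  destruct m as [|m]; [now split|].
  destruct H as [_ [h' [Hd Hh']]]; split; [easy|].
  exists h'; split; [|easy]; intros i t Ht.
  apply is_derive_ext_loc with (h i); [|auto].
  exists (mkposreal t ltac:(lra)); intros y Hy; apply E.
  change (Rabs (y - t) < t) in Hy.
  apply Rabs_def2 in Hy; lra.
Qed.

Lemma symbol_plus m p h g :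
  symbol m p h -> symbol m p g -> symbol m p (fun i t => h i t + g i t).
Proof.
  revert p h g; induction m as [|m IH]; intros p h g Hh Hg;
    destruct (symbol_bound _ _ _ Hh) as [C HC], (symbol_bound _ _ _ Hg) as [D HD];
    (split;
     [exists (C + D); intros i t Ht;
      eapply Rle_trans; [apply Rabs_triang|];
      specialize (HC i t Ht); specialize (HD i t Ht); lra|]); [easy|].
  destruct Hh as [_ [h' [Hh Hh']]], Hg as [_ [g' [Hg Hg']]].
  exists (fun i t => h' i t + g' i t); split; [|now apply IH].
  intros i t Ht; apply (is_derive_plus (h i) (g i)); auto.
Qed.

Lemma symbol_scal m p c h :
  symbol m p h -> symbol m p (fun i t => c * h i t).
Proof.
  revert p h; induction m as [|m IH]; intros p h Hh;
    destruct (symbol_bound _ _ _ Hh) as [C HC];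
    (split;
     [exists (Rabs c * C); intros i t Ht; rewrite Rabs_mult;
      replace (Rabs c * C * w i * Rpower t p)
        with (Rabs c * (C * w i * Rpower t p)) by ring;
      apply Rmult_le_compat_l; [apply Rabs_pos|auto]|]); [easy|].
  destruct Hh as [_ [h' [Hh Hh']]].
  exists (fun i t => c * h' i t); split; [|now apply IH].
  intros i t Ht; apply (is_derive_scal (h i)); auto.
Qed.

Lemma symbol_minus m p h g :
  symbol m p h -> symbol m p g -> symbol m p (fun i t => h i t - g i t).
Proof.
  intros Hh Hg.
  refine (symbol_ext _ _ _ _ _ (symbol_plus _ _ _ _ Hh (symbol_scal _ _ (-1) _ Hg))).
  intros i t _; ring.
Qed.

(** By the mean value theorem [h t - h (t + 1) = - h' c] with [t <= c <= t + 1]: one controlled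
    derivative is spent and the order falls by one. *)
Lemma symbol_diff m p h :
  symbol (S m) p h -> symbol m (p - 1) (fun i t => h i t - h i (t + 1)).
Proof.
  revert p h; induction m as [|m IH]; intros p h [_ [h' [Hd Hh']]];
    destruct (symbol_bound _ _ _ Hh') as [C HC];
    (split; [exists (C * Rpower (1 + / a) (Rabs (p - 1))); intros i t Ht|]).
  1, 3 :
    destruct (MVT_gen (h i) t (t + 1) (h' i)) as [c [Hc E]];
    [ intros x; rewrite Rmin_left by lra; intros Hx; apply Hd; lra
    | intros x; rewrite Rmin_left by lra; intros Hx;
      apply derivable_continuous_pt; exists (h' i x); apply is_derive_Reals, Hd; lra
    | rewrite Rmin_left, Rmax_right in Hc by lra;
      rewrite Rabs_minus_sym, E;
      replace (t + 1 - t) with 1 by ring; rewrite Rmult_1_r;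
      pose proof (HC i c ltac:(lra)) as Hb;
      pose proof (HC i t Ht) as Hb0;
      pose proof (Rpower_ratio_bound a t c (p - 1) ha Ht ltac:(lra)) as Hr;
      eapply Rle_trans; [exact Hb|];
      (* The signs of [C] and [w i] are unknown, but the bound at [t] forces their product to be
         nonnegative. *)
      assert (0 <= C * w i) by
        (apply (Rmult_le_reg_r (Rpower t (p - 1))); [apply exp_pos|];
         rewrite Rmult_0_l; eapply Rle_trans; [apply Rabs_pos|exact Hb0]);
      replace (C * Rpower (1 + / a) (Rabs (p - 1)) * w i * Rpower t (p - 1))
        with (C * w i * (Rpower (1 + / a) (Rabs (p - 1)) * Rpower t (p - 1))) by ring;
      now apply Rmult_le_compat_l ].
  - easy.
  - exists (fun i t => h' i t - h' i (t + 1)); split; [|now apply IH].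
    intros i t Ht.
    apply (is_derive_minus (h i) (fun t => h i (t + 1))); [now apply Hd|].
    replace (h' i (t + 1)) with (scal 1 (h' i (t + 1)))
      by (unfold scal; simpl; unfold mult; simpl; ring).
    apply (is_derive_comp (h i) (fun t => t + 1)); [apply Hd; lra|].
    auto_derive; [easy|ring].
Qed.

(** After [m] differences the order is at most [-2] and the series converges absolutely; its bound
    is carried back through the [m] levels, uniformly in [i]. *)
Lemma symbol_euler_level m p h :
  symbol m p h -> p - INR m <= -2 ->
  exists (l : I -> R) C, forall i,
    euler_level m (fun k => h i (INR k + a)) (l i) /\ Rabs (l i) <= C * w i.
Proof.
  assert (Hpos : forall k, a <= INR k + a).
  { intros k; pose proof (pos_INR k); lra. }
  revert p h; induction m as [|m IH]; intros p h Hh Hp.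
  - destruct (symbol_bound _ _ _ Hh) as [C HC].
    rewrite Rminus_0_r in Hp.
    pose proof (ex_series_Rpower a p ha Hp) as Hs.
    exists (fun i => Series (fun k => (-1) ^ k * h i (INR k + a))).
    exists (C * Series (fun k => Rpower (INR k + a) p)).
    intros i.
    assert (Hb : forall k, Rabs ((-1) ^ k * h i (INR k + a))
                           <= C * w i * Rpower (INR k + a) p).
    { intros k; rewrite Rabs_mult, pow_1_abs, Rmult_1_l; auto. }
    pose proof (ex_series_scal_l (C * w i) _ Hs) as Hs'.
    assert (Ha : ex_series (fun k => Rabs ((-1) ^ k * h i (INR k + a)))).
    { refine (ex_series_le (K := R_AbsRing) (V := R_CompleteNormedModule) _ _ _ Hs').
      intros k; unfold norm; simpl; unfold abs; simpl.
      rewrite Rabs_Rabsolu; apply Hb. }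
    split.
    + apply Series_correct, ex_series_Rabs, Ha.
    + eapply Rle_trans; [apply Series_Rabs, Ha|].
      replace (C * _ * w i) with (C * w i * Series (fun k => Rpower (INR k + a) p))
        by ring.
      rewrite <- Series_scal_l.
      apply Series_le; [|exact Hs'].
      intros k; split; [apply Rabs_pos|apply Hb].
  - rewrite S_INR in Hp.
    destruct (IH _ _ (symbol_diff _ _ _ Hh) ltac:(lra)) as [l [C Hl]].
    destruct (symbol_bound _ _ _ Hh) as [D HD].
    (* Solves [2 * l - u_0 = l'] for [l], where [l'] is the sum of the differenced sequence and
       [u_0 = h i a]. *)
    exists (fun i => (l i + h i a) / 2), ((C + D * Rpower a p) / 2); intros i.
    destruct (Hl i) as [Hs Hb]; split.
    + cbn [euler_level]; change (INR 0) with 0; rewrite Rplus_0_l.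
      replace (2 * _ - _) with (l i) by field.
      refine (euler_level_ext _ _ _ _ _ Hs); intros k; cbv beta.
      rewrite S_INR; do 2 f_equal; ring.
    + specialize (HD i a (Rle_refl a)).
      unfold Rdiv; rewrite Rabs_mult, (Rabs_pos_eq (/ 2)) by lra.
      pose proof (Rabs_triang (l i) (h i a)); lra.
Qed.

Lemma symbol_euler_sum p h :
  (forall m, symbol m p h) ->
  exists (l : I -> R) C, forall i,
    euler_sum (fun k => h i (INR k + a)) (l i) /\ Rabs (l i) <= C * w i.
Proof.
  intros H.
  destruct (INR_unbounded (p + 2)) as [m Hm].
  destruct (symbol_euler_level m p h (H m) ltac:(lra)) as [l [C Hl]].
  exists l, C; intros i; destruct (Hl i); split; [now exists m|easy].
Qed.

End Symbols.

Arguments symbol a {I} w m p h.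

(** Leibniz rule: in each product one factor is differentiated, while the other gives up a
    controlled derivative through [symbol_pred]. *)
Lemma symbol_mult a I (w : I -> R) m p q f h :
  0 < a ->
  symbol a (fun _ : unit => 1) m p (fun _ => f) -> symbol a w m q h ->
  symbol a w m (p + q) (fun i t => f t * h i t).
Proof.
  intros ha; revert p q f h; induction m as [|m IH]; intros p q f h Hf Hh;
    destruct (symbol_bound _ _ _ _ _ _ Hf) as [C HC],
      (symbol_bound _ _ _ _ _ _ Hh) as [D HD];
    (split;
     [exists (C * D); intros i t Ht; rewrite Rabs_mult;
      replace (C * D * w i * Rpower t (p + q))
        with (C * 1 * Rpower t p * (D * w i * Rpower t q))
        by (rewrite Rpower_plus; ring);
      apply Rmult_le_compat; try apply Rabs_pos;
        [now apply (HC tt)|auto]|]); [easy|].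
  pose proof (symbol_pred _ _ _ _ _ _ Hf) as Pf.
  pose proof (symbol_pred _ _ _ _ _ _ Hh) as Ph.
  destruct Hf as [_ [f' [Hf Hf']]], Hh as [_ [h' [Hh Hh']]].
  exists (fun i t => f' tt t * h i t + f t * h' i t); split.
  - intros i t Ht.
    apply (is_derive_mult f (h i)); [now apply (Hf tt)|auto|].
    intros; apply Rmult_comm.
  - apply symbol_plus.
    + replace (p + q - 1) with (p - 1 + q) by ring.
      apply (IH _ _ (f' tt)); [|easy].
      now refine (symbol_ext _ ha _ _ _ _ _ _ _ Hf'); intros [] t _.
    + replace (p + q - 1) with (p + (q - 1)) by ring; now apply IH.
Qed.

(** * Powers and binomial remainders *)

Lemma is_derive_Rpower q t :
  0 < t -> is_derive (fun t => Rpower t q) t (q * Rpower t (q - 1)).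
Proof. intros ht; apply is_derive_Reals, derivable_pt_lim_power, ht. Qed.

Lemma Rpower_m1 t : 0 < t -> Rpower t (-1) = / t.
Proof.
  intros ht; change (-1) with (- (1)); now rewrite Rpower_Ropp, Rpower_1.
Qed.

Lemma symbol_Rpower a m q :
  0 < a -> symbol a (fun _ : unit => 1) m q (fun _ t => Rpower t q).
Proof.
  intros ha; revert q; induction m as [|m IH]; intros q;
    (split; [exists 1; intros _ t Ht; rewrite Rabs_pos_eq; [lra|left; apply exp_pos]|]);
    [easy|].
  exists (fun _ t => q * Rpower t (q - 1)); split.
  - intros _ t Ht; apply is_derive_Rpower; lra.
  - apply (symbol_scal _ _ _ _ _ q (fun _ t => Rpower t (q - 1))), IH.
Qed.

(* Bounds in the class [S^p] follow from bounds on the powers of the Euler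
   operator [t d/dt], which all have order [p]. *)
Lemma symbol_intro a I (w : I -> R) m p h g :
  0 < a ->
  (exists C, forall i t, a <= t -> Rabs (h i t) <= C * w i * Rpower t p) ->
  (forall i t, a <= t -> is_derive (h i) t (/ t * g i t)) ->
  symbol a w m p g -> symbol a w (S m) p h.
Proof.
  intros ha Hb Hd Hg; split; [easy|].
  exists (fun i t => / t * g i t); split; [easy|].
  replace (p - 1) with (-1 + p) by ring.
  apply (symbol_ext _ ha _ _ _ _ (fun i t => Rpower t (-1) * g i t)).
  - intros i t Ht; now rewrite Rpower_m1.
  - apply symbol_mult; [easy|now apply symbol_Rpower|easy].
Qed.

(** These are the real and imaginary parts of [t^(x + i y)]. The operator [t d/dt] maps their span
    to itself, so the two inductions run together. *)
Lemma symbol_trig a x y m :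
  0 < a ->
  symbol a (fun _ : unit => 1) m x (fun _ t => exp (x * ln t) * cos (y * ln t)) /\
  symbol a (fun _ : unit => 1) m x (fun _ t => exp (x * ln t) * sin (y * ln t)).
Proof.
  intros ha.
  assert (Hb : forall c, Rabs c <= 1 -> forall t,
             Rabs (exp (x * ln t) * c) <= 1 * 1 * Rpower t x).
  { intros c Hc t; rewrite Rabs_mult, Rabs_pos_eq by (left; apply exp_pos).
    pose proof (exp_pos (x * ln t)); unfold Rpower; nra. }
  assert (Hc : forall u, Rabs (cos u) <= 1)
    by (intros u; apply Rabs_le, COS_bound).
  assert (Hs : forall u, Rabs (sin u) <= 1)
    by (intros u; apply Rabs_le, SIN_bound).
  induction m as [|m [IHc IHs]].
  - split; (split; [exists 1; intros _ t _; now apply Hb|easy]).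
  - split.
    + apply (symbol_intro _ _ _ _ _ _ (fun _ t => x * (exp (x * ln t) * cos (y * ln t))
               - y * (exp (x * ln t) * sin (y * ln t)))); [easy| | |].
      * exists 1; intros _ t _; now apply Hb.
      * intros _ t Ht; auto_derive; [lra|field; lra].
      * now apply symbol_minus; [| apply symbol_scal ..].
    + apply (symbol_intro _ _ _ _ _ _ (fun _ t => x * (exp (x * ln t) * sin (y * ln t))
               + y * (exp (x * ln t) * cos (y * ln t)))); [easy| | |].
      * exists 1; intros _ t _; now apply Hb.
      * intros _ t Ht; auto_derive; [lra|field; lra].
      * now apply symbol_plus; apply symbol_scal.
Qed.

(** The Pochhammer symbol; [Gamma_rising] identifies it with the quotient of Gamma values in the
    expansion. *)
Fixpoint rising (mu : R) (j : nat) : R :=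
  match j with
  | O => 1
  | S j' => rising mu j' * (mu + INR j')
  end.

Lemma rising_shift mu j : mu * rising (mu + 1) j = rising mu j * (mu + INR j).
Proof.
  induction j as [|j IH]; cbn [rising].
  - simpl; ring.
  - rewrite <- Rmult_assoc, IH, S_INR; ring.
Qed.

(** The binomial coefficient of [-mu] over [j], that is, the Taylor coefficient of [(1+u)^(-mu)] at
    [0]. *)
Definition binom_coef (mu : R) (j : nat) : R :=
  (-1) ^ j / INR (fact j) * rising mu j.

(** The Taylor remainder of [(1+u)^(-mu)] after [M] terms. Removing the terms one at a time mirrors
    the way the partial sums of the expansion are subtracted. *)
Fixpoint binom_rest (M : nat) (mu u : R) : R :=
  match M with
  | O => Rpower (1 + u) (- mu)
  | S M' => binom_rest M' mu u - binom_coef mu M' * u ^ M'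
  end.

Lemma binom_coef_shift mu j :
  mu * binom_coef (mu + 1) j = binom_coef mu j * (mu + INR j).
Proof.
  unfold binom_coef.
  replace (mu * _) with ((-1) ^ j / INR (fact j) * (mu * rising (mu + 1) j)) by ring.
  rewrite rising_shift; ring.
Qed.

Lemma binom_coef_S mu j :
  INR (S j) * binom_coef mu (S j) = - mu * binom_coef (mu + 1) j.
Proof.
  replace (- mu * _) with (- (mu * binom_coef (mu + 1) j)) by ring.
  rewrite binom_coef_shift; unfold binom_coef.
  rewrite fact_simpl, mult_INR; cbn [rising pow].
  field; split; [apply INR_fact_neq_0|apply not_0_INR; lia].
Qed.

Lemma is_derive_binom_power mu u :
  0 < 1 + u ->
  is_derive (fun u => Rpower (1 + u) (- mu)) u (- mu * Rpower (1 + u) (- (mu + 1))).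
Proof.
  intros hu; unfold Rpower; auto_derive; [easy|].
  replace (- (mu + 1) * ln (1 + u)) with (- mu * ln (1 + u) + - ln (1 + u)) by ring.
  rewrite exp_plus, exp_Ropp, exp_ln by easy; field; lra.
Qed.

(** By [binom_coef_S], a Taylor term for [mu] differentiates to [-mu] times the preceding term for
    [mu + 1], so one subtracted term is lost. *)
Lemma is_derive_binom_rest M mu u :
  0 < 1 + u ->
  is_derive (binom_rest (S M) mu) u (- mu * binom_rest M (mu + 1) u).
Proof.
  intros hu; induction M as [|M IH].
  - cbn [binom_rest].
    replace (- mu * _) with (minus (- mu * Rpower (1 + u) (- (mu + 1))) 0)
      by (unfold minus, plus, opp; simpl; ring).
    apply (is_derive_minus (fun u => Rpower (1 + u) (- mu))).
    + now apply is_derive_binom_power.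
    + auto_derive; [easy|ring].
  - cbn [binom_rest] in *.
    replace (- mu * _) with (minus (- mu * binom_rest M (mu + 1) u)
        (- mu * binom_coef (mu + 1) M * u ^ M))
      by (unfold minus, plus, opp; simpl; ring).
    apply (is_derive_minus
      (fun u => binom_rest M mu u - binom_coef mu M * u ^ M)
      (fun u => binom_coef mu (S M) * u ^ S M)); [exact IH|].
    rewrite <- binom_coef_S.
    auto_derive; [easy|].
    change (INR (S M)) with (match M with O => 1 | S _ => INR M + 1 end); ring.
Qed.

(** Unlike [d/du], the operator [u d/du] keeps the number [M] of subtracted terms. This rests on [u
    (1+u)^(-mu-1) = (1+u)^(-mu) - (1+u)^(-mu-1)] for the power and on
    [j c_j(mu) = mu (c_j(mu+1) - c_j(mu))] for the coefficients. *)
Lemma is_derive_binom_rest_euler M mu u :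
  0 < u ->
  is_derive (binom_rest M mu) u
    (/ u * (- mu * (binom_rest M mu u - binom_rest M (mu + 1) u))).
Proof.
  intros hu; induction M as [|M IH]; cbn [binom_rest].
  - replace (/ u * _) with (- mu * Rpower (1 + u) (- (mu + 1))).
    + apply is_derive_binom_power; lra.
    + replace (- mu) with (- (mu + 1) + 1) at 3 by ring.
      rewrite Rpower_plus, Rpower_1 by lra; field; lra.
  - replace (/ u * _) with
      (minus (/ u * (- mu * (binom_rest M mu u - binom_rest M (mu + 1) u)))
         (/ u * (INR M * binom_coef mu M * u ^ M))).
    + apply (is_derive_minus (binom_rest M mu)); [exact IH|].
      auto_derive; [easy|]; destruct M as [|M]; simpl; field; lra.
    + unfold minus, plus, opp; simpl.
      pose proof (binom_coef_shift mu M) as E.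
      replace (INR M * binom_coef mu M) with
        (mu * binom_coef (mu + 1) M - mu * binom_coef mu M) by lra.
      ring.
Qed.

Lemma binom_rest_0 M mu : binom_rest (S M) mu 0 = 0.
Proof.
  induction M as [|M IH]; cbn [binom_rest] in *.
  - rewrite Rplus_0_r; unfold Rpower, binom_coef; rewrite ln_1; simpl.
    rewrite Rmult_0_r, exp_0; field.
  - rewrite IH; simpl; ring.
Qed.

(** Mean value theorem from [0], where the remainder vanishes: its derivative is a multiple of the
    remainder with one term less for [mu + 1], hence the induction over all [mu]. *)
Lemma binom_rest_bound M mu :
  0 < mu -> exists C, forall u, 0 <= u -> Rabs (binom_rest M mu u) <= C * u ^ M.
Proof.
  revert mu; induction M as [|M IH]; intros mu hmu.
  - exists 1; intros u hu; simpl.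
    rewrite Rabs_pos_eq by (left; apply exp_pos).
    rewrite Rmult_1_r; apply Rle_trans with (Rpower (1 + u) 0).
    + apply Rle_Rpower; lra.
    + rewrite Rpower_O by lra; lra.
  - destruct (IH (mu + 1) ltac:(lra)) as [C HC].
    exists (mu * C); intros u hu.
    destruct (MVT_gen (binom_rest (S M) mu) 0 u
                (fun u => - mu * binom_rest M (mu + 1) u)) as [c [Hc E]].
    + rewrite Rmin_left by lra; intros v Hv; apply is_derive_binom_rest; lra.
    + rewrite Rmin_left by lra; intros v Hv; apply derivable_continuous_pt.
      eexists; apply is_derive_Reals, is_derive_binom_rest; lra.
    + rewrite Rmin_left, Rmax_right in Hc by lra.
      rewrite binom_rest_0, !Rminus_0_r in E; rewrite E.
      rewrite !Rabs_mult, Rabs_Ropp, (Rabs_pos_eq mu), (Rabs_pos_eq u) by lra.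
      replace (mu * C * u ^ S M) with (mu * (C * u ^ M) * u) by (simpl; ring).
      apply Rmult_le_compat_r; [easy|]; apply Rmult_le_compat_l; [lra|].
      eapply Rle_trans; [apply HC; lra|].
      apply Rmult_le_compat_l; [|apply pow_incr; lra].
      (* The bound at [1] shows that [C] is nonnegative. *)
      specialize (HC 1 ltac:(lra)); rewrite pow1 in HC.
      pose proof (Rabs_pos (binom_rest M (mu + 1) 1)); lra.
Qed.

(** On functions of [u = x t^alpha] the operator [t d/dt] acts as [alpha u d/du], which yields
    remainders for [mu] and [mu + 1] with the same [M]. Order and weight therefore persist at every
    derivative. *)
Lemma symbol_binom_rest a alpha M m mu :
  0 < a -> 0 < mu ->
  symbol a (fun x : posreal => x ^ M) m (alpha * INR M)
    (fun x t => binom_rest M mu (x * Rpower t alpha)).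
Proof.
  intros ha; revert mu; induction m as [|m IH]; intros mu hmu.
  all: assert (Hb : exists C, forall (x : posreal) t, a <= t ->
      Rabs (binom_rest M mu (x * Rpower t alpha))
        <= C * x ^ M * Rpower t (alpha * INR M)).
  1, 3 : destruct (binom_rest_bound M mu hmu) as [C HC]; exists C; intros x t Ht;
    rewrite <- Rpower_mult, Rpower_pow by apply exp_pos;
    rewrite Rmult_assoc, <- Rpow_mult_distr; apply HC;
    apply Rmult_le_pos; left; [apply cond_pos|apply exp_pos].
  - now split.
  - apply (symbol_intro _ _ _ _ _ _ (fun (x : posreal) t => - mu * alpha *
      (binom_rest M mu (x * Rpower t alpha)
       - binom_rest M (mu + 1) (x * Rpower t alpha)))); [easy..| |].
    + intros x t Ht.
      pose proof (cond_pos x) as hx; pose proof (exp_pos (alpha * ln t)) as ht.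
      fold (Rpower t alpha) in ht.
      assert (hu : 0 < x * Rpower t alpha) by now apply Rmult_lt_0_compat.
      set (g := binom_rest M mu (x * Rpower t alpha)
                - binom_rest M (mu + 1) (x * Rpower t alpha)).
      replace (/ t * _) with
        (scal (x * (alpha * Rpower t (alpha - 1)))
           (/ (x * Rpower t alpha) * (- mu * g))).
      * apply (is_derive_comp (binom_rest M mu) (fun t => x * Rpower t alpha)).
        -- now apply is_derive_binom_rest_euler.
        -- apply (is_derive_scal (fun t => Rpower t alpha)), is_derive_Rpower; lra.
      * unfold scal; simpl; unfold mult; simpl.
        replace (alpha - 1) with (alpha + -1) by ring.
        rewrite Rpower_plus, Rpower_m1 by lra; field; lra.
    + apply symbol_scal, symbol_minus; [easy|apply IH; lra..].
Qed.

(** * Exponential remainders *)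

Lemma Cexp_plus u v : Cexp (u + v)%C = (Cexp u * Cexp v)%C.
Proof.
  destruct u as [ux uy], v as [vx vy]; unfold Cexp, Cmult, Cplus; simpl.
  rewrite exp_plus, cos_plus, sin_plus; f_equal; ring.
Qed.

Lemma Cexp_0 : Cexp (RtoC 0) = RtoC 1.
Proof.
  unfold Cexp, RtoC; simpl; rewrite exp_0, cos_0, sin_0; f_equal; ring.
Qed.

Lemma Cexp_neq_0 u : Cexp u <> RtoC 0.
Proof.
  intros E; apply C1_nz; rewrite <- Cexp_0.
  replace (RtoC 0) with (u + - u)%C by ring; rewrite Cexp_plus, E; ring.
Qed.

Lemma Cpower_opp t s : Cpower t (- s) = (/ Cpower t s)%C.
Proof.
  unfold Cpower.
  replace (- s * RtoC (ln t))%C with (- (s * RtoC (ln t)))%C by ring.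
  set (u := (s * RtoC (ln t))%C).
  assert (E : (Cexp u * Cexp (- u))%C = RtoC 1)
    by (rewrite <- Cexp_plus, <- Cexp_0; f_equal; ring).
  rewrite <- (Cmult_1_r (/ Cexp u)), <- E; field; apply Cexp_neq_0.
Qed.

Lemma Cpower_trig t x y :
  Cpower t (x, y) = (exp (x * ln t) * cos (y * ln t), exp (x * ln t) * sin (y * ln t)).
Proof.
  unfold Cpower, Cexp, Cmult; simpl.
  replace (x * ln t - y * 0) with (x * ln t) by ring.
  now replace (x * 0 + y * ln t) with (y * ln t) by ring.
Qed.

Lemma Cpower_real t x : Cpower t (RtoC x) = RtoC (Rpower t x).
Proof.
  unfold RtoC at 1; rewrite Cpower_trig, Rmult_0_l, cos_0, sin_0.
  unfold RtoC, Rpower; f_equal; ring.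
Qed.

(** The Taylor remainder of [exp (z L)] after [N] terms; at [L = - ln t] it is the remainder of
    [t^(-z)] as a function of [z]. *)
Fixpoint exp_rest (N : nat) (z : C) (L : R) : C :=
  match N with
  | O => Cexp (z * RtoC L)
  | S N' => exp_rest N' z L
            - pow_n (K := C_Ring) z N' * RtoC (L ^ N' / INR (fact N'))
  end%C.

Lemma is_derive_pow_fact n L :
  is_derive (fun L => L ^ S n / INR (fact (S n))) L (L ^ n / INR (fact n)).
Proof.
  auto_derive; [easy|].
  change (match n with 0%nat => 1 | S _ => INR n + 1 end) with (INR (S n)).
  change (fact n + n * fact n)%nat with (fact (S n)).
  rewrite fact_simpl, mult_INR; simpl Init.Nat.pred.
  field; split; [apply INR_fact_neq_0|apply not_0_INR; lia].
Qed.

(** The value [pred 0 = 0] is the right one: the full exponential reproduces itself up to the factor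
    [z], while a proper remainder loses one subtracted term. *)
Lemma is_derive_exp_rest N z L :
  is_derive (fun L => Re (exp_rest N z L)) L (Re (z * exp_rest (pred N) z L)%C) /\
  is_derive (fun L => Im (exp_rest N z L)) L (Im (z * exp_rest (pred N) z L)%C).
Proof.
  induction N as [|N [IHr IHi]].
  - destruct z as [x y]; unfold exp_rest, Cexp; simpl; split;
      (auto_derive; [easy|]); unfold Rminus;
      replace (x * L + - (y * 0)) with (x * L) by ring;
      replace (x * 0 + y * L) with (y * L) by ring; ring.
  (* Here [q] is the derivative of the term subtracted last: zero if that term is constant,
     otherwise [z] times the term before it. *)
  - assert (H : exists p q,
      is_derive (fun L => L ^ N / INR (fact N)) L p /\
      (pow_n (K := C_Ring) z N * RtoC p = q)%C /\
      (z * exp_rest (pred (S N)) z L = z * exp_rest (pred N) z L - q)%C).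
    { destruct N as [|N].
      - exists 0, (RtoC 0); split; [simpl; auto_derive; [easy|ring]|].
        split; [apply Cmult_0_r|simpl; ring].
      - eexists; eexists; split; [apply is_derive_pow_fact|].
        split; [reflexivity|]; cbn [exp_rest Init.Nat.pred].
        change (pow_n (K := C_Ring) z (S N)) with (z * pow_n (K := C_Ring) z N)%C.
        ring. }
    destruct H as [p [q [Hp [Hq E]]]]; rewrite E, <- Hq; clear E Hq q.
    destruct (pow_n (K := C_Ring) z N) as [c d] eqn:Ec; split.
    + apply (is_derive_ext (fun L => Re (exp_rest N z L) - c * (L ^ N / INR (fact N)))).
      { intros u; simpl; rewrite Ec; simpl; unfold Re, Im; ring. }
      replace (Re _) with (minus (Re (z * exp_rest (pred N) z L)%C) (c * p))
        by (unfold minus, plus, opp; simpl; unfold Re, Im; ring).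
      apply (is_derive_minus (fun L => Re (exp_rest N z L))); [exact IHr|].
      now apply (is_derive_scal (fun L => L ^ N / INR (fact N))).
    + apply (is_derive_ext (fun L => Im (exp_rest N z L) - d * (L ^ N / INR (fact N)))).
      { intros u; simpl; rewrite Ec; simpl; unfold Re, Im; ring. }
      replace (Im (_ - _)%C) with (minus (Im (z * exp_rest (pred N) z L)%C) (d * p))
        by (unfold minus, plus, opp; simpl; unfold Re, Im; ring).
      apply (is_derive_minus (fun L => Im (exp_rest N z L))); [exact IHi|].
      now apply (is_derive_scal (fun L => L ^ N / INR (fact N))).
Qed.

Lemma exp_rest_0 N z : exp_rest (S N) z 0 = RtoC 0.
Proof.
  induction N as [|N IH].
  - simpl; rewrite Cmult_0_r, Cexp_0; unfold one; simpl.
    rewrite Rdiv_1_r; ring.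
  - change (exp_rest (S (S N)) z 0) with
      (exp_rest (S N) z 0
       - pow_n (K := C_Ring) z (S N) * RtoC (0 ^ S N / INR (fact (S N))))%C.
    rewrite IH, pow_i, Rdiv_0_l by lia; ring.
Qed.

(** Comparison with [B exp (rho u)], which starts at [B >= 0 = f 0] and whose derivative dominates
    that of [f]. The lower bound comes from [- f], negative [L] from reflection. *)
Lemma exp_growth_bound (f f' : R -> R) B rho L :
  0 < rho -> f 0 = 0 ->
  (forall u, is_derive f u (f' u)) ->
  (forall u, Rabs (f' u) <= B * rho * exp (rho * Rabs u)) ->
  Rabs (f L) <= B * exp (rho * Rabs L).
Proof.
  intros hrho.
  assert (hB0 : forall g' : R -> R,
    (forall u, Rabs (g' u) <= B * rho * exp (rho * Rabs u)) -> 0 <= B).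
  { intros g' Hg; specialize (Hg 0); rewrite Rabs_R0, Rmult_0_r, exp_0 in Hg.
    pose proof (Rabs_pos (g' 0)); nra. }
  assert (Hup : forall (f f' : R -> R), f 0 = 0 -> (forall u, is_derive f u (f' u)) ->
    (forall u, Rabs (f' u) <= B * rho * exp (rho * Rabs u)) ->
    forall L, 0 <= L -> f L <= B * exp (rho * L)).
  { clear f f' L; intros f f' H0 Hd Hb L HL.
    pose proof (hB0 _ Hb) as hB.
    destruct (MVT_gen (fun u => B * exp (rho * u) - f u) 0 L
                (fun u => B * rho * exp (rho * u) - f' u)) as [c [Hc E]].
    1, 2 : assert (Hd' : forall u, is_derive (fun u => B * exp (rho * u) - f u) u
                (B * rho * exp (rho * u) - f' u))
      by (intros u; apply (is_derive_minus (fun u => B * exp (rho * u)) f); [|easy];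
          auto_derive; [easy|ring]).
    - now intros.
    - intros u _; apply derivable_continuous_pt; eexists; apply is_derive_Reals, Hd'.
    - rewrite Rmin_left, Rmax_right in Hc by lra.
      rewrite H0, Rmult_0_r, exp_0 in E.
      specialize (Hb c); rewrite (Rabs_pos_eq c) in Hb by lra.
      pose proof (Rle_abs (f' c)); nra. }
  assert (Habs : forall (f f' : R -> R), f 0 = 0 -> (forall u, is_derive f u (f' u)) ->
    (forall u, Rabs (f' u) <= B * rho * exp (rho * Rabs u)) ->
    forall L, 0 <= L -> Rabs (f L) <= B * exp (rho * L)).
  { clear f f' L; intros f f' H0 Hd Hb L HL; apply Rabs_le; split.
    - cut (- f L <= B * exp (rho * L)); [lra|].
      apply (Hup (fun u => - f u) (fun u => - f' u)); [lra| | |easy].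
      + intros u; now apply (is_derive_opp f).
      + intros u; now rewrite Rabs_Ropp.
    - now apply (Hup f f'). }
  intros H0 Hd Hb.
  destruct (Rle_dec 0 L) as [hL|hL].
  - rewrite (Rabs_pos_eq L) by easy; now apply (Habs f f').
  - rewrite (Rabs_left L) by lra.
    replace (f L) with (f (- - L)) by (f_equal; ring).
    apply (Habs (fun u => f (- u)) (fun u => - f' (- u))); [| | |lra].
    + now rewrite Ropp_0.
    + intros u; replace (- f' (- u)) with (scal (-1) (f' (- u)))
        by (unfold scal; simpl; unfold mult; simpl; ring).
      apply (is_derive_comp f (fun u => - u)); [easy|].
      auto_derive; [easy|ring].
    + intros u; rewrite Rabs_Ropp; specialize (Hb (- u)).
      now rewrite (Rabs_Ropp u) in Hb.
Qed.

(** The factor [2] provides the gain of [1/2] at each step of [exp_rest_bound]; the [+ 1] keeps the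
    rate positive at [z = 0]. *)
Definition growth (z : C) : R := 2 * (Rabs (Re z) + Rabs (Im z)) + 1.

Lemma growth_pos z : 0 < growth z.
Proof.
  unfold growth; pose proof (Rabs_pos (Re z)); pose proof (Rabs_pos (Im z)); lra.
Qed.

(* Trading the factorial decay for the geometric factor [(1/2)^N] keeps the
   exponential rate, hence the order as a symbol in [t], independent of [N]. *)
Lemma exp_rest_bound N z L :
  Rabs (Re (exp_rest N z L)) <= (/ 2) ^ N * exp (growth z * Rabs L) /\
  Rabs (Im (exp_rest N z L)) <= (/ 2) ^ N * exp (growth z * Rabs L).
Proof.
  pose proof (growth_pos z) as hg.
  revert L; induction N as [|N IH]; intros L.
  - destruct z as [x y]; simpl exp_rest; unfold Cexp; simpl.
    replace (x * L - y * 0) with (x * L) by ring.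
    replace (x * 0 + y * L) with (y * L) by ring.
    assert (He : exp (x * L) <= exp (growth (x, y) * Rabs L)).
    { assert (h : x * L <= growth (x, y) * Rabs L).
      { eapply Rle_trans; [apply Rle_abs|]; rewrite Rabs_mult.
        apply Rmult_le_compat_r; [apply Rabs_pos|].
        unfold growth; simpl; pose proof (Rabs_pos x); pose proof (Rabs_pos y); lra. }
      destruct h as [h|h]; [left; now apply exp_increasing|right; now rewrite h]. }
    pose proof (exp_pos (x * L)) as hp.
    rewrite !Rabs_mult, (Rabs_pos_eq (exp _)), Rmult_1_l by lra.
    assert (Hc : Rabs (cos (y * L)) <= 1) by apply Rabs_le, COS_bound.
    assert (Hs : Rabs (sin (y * L)) <= 1) by apply Rabs_le, SIN_bound.
    split; nra.
  (* The components of [z * exp_rest N z u] are such combinations. Half of [growth z] gives the next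
     [1/2], and the remaining factor [growth z] is absorbed on integration by [exp_growth_bound]. *)
  - assert (Hb : forall u c d, Rabs c + Rabs d <= growth z / 2 ->
      Rabs (c * Re (exp_rest N z u) + d * Im (exp_rest N z u))
        <= (/ 2) ^ S N * growth z * exp (growth z * Rabs u)).
    { intros u c d Hcd; destruct (IH u) as [Hr Hi].
      eapply Rle_trans; [apply Rabs_triang|]; rewrite !Rabs_mult.
      apply Rle_trans with
        ((Rabs c + Rabs d) * ((/ 2) ^ N * exp (growth z * Rabs u))).
      - pose proof (Rabs_pos c); pose proof (Rabs_pos d); nra.
      - simpl; replace (/ 2 * (/ 2) ^ N * growth z * exp (growth z * Rabs u)) with
          (growth z / 2 * ((/ 2) ^ N * exp (growth z * Rabs u))) by field.
        apply Rmult_le_compat_r; [|easy].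
        apply Rmult_le_pos; [apply pow_le; lra|left; apply exp_pos]. }
    assert (hz : Rabs (Re z) + Rabs (Im z) <= growth z / 2) by (unfold growth; lra).
    split.
    + apply (exp_growth_bound (fun L => Re (exp_rest (S N) z L))
               (fun u => Re (z * exp_rest N z u)%C) _ _ _ hg).
      * now rewrite exp_rest_0.
      * intros u; apply is_derive_exp_rest.
      * intros u; simpl Re.
        replace (_ - _) with
          (Re z * Re (exp_rest N z u) + (- Im z) * Im (exp_rest N z u))
          by (unfold Re, Im; ring).
        apply Hb; now rewrite Rabs_Ropp.
    + apply (exp_growth_bound (fun L => Im (exp_rest (S N) z L))
               (fun u => Im (z * exp_rest N z u)%C) _ _ _ hg).
      * now rewrite exp_rest_0.
      * intros u; apply is_derive_exp_rest.
      * intros u; simpl Im.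
        replace (_ + _) with
          (Im z * Re (exp_rest N z u) + Re z * Im (exp_rest N z u))
          by (unfold Re, Im; ring).
        apply Hb; now rewrite Rplus_comm.
Qed.

(** Since [ln t >= ln a], the value [|ln t|] exceeds [ln t] by at most [2 |ln a|]. *)
Lemma exp_abs_ln_bound a rho t :
  0 < rho -> 0 < a <= t ->
  exp (rho * Rabs (- ln t)) <= exp (2 * rho * Rabs (ln a)) * Rpower t rho.
Proof.
  intros hrho [ha ht]; unfold Rpower; rewrite <- exp_plus, Rabs_Ropp.
  assert (hl : ln a <= ln t) by now apply ln_le.
  assert (h : rho * Rabs (ln t) <= 2 * rho * Rabs (ln a) + rho * ln t).
  { replace (2 * rho * Rabs (ln a) + rho * ln t)
      with (rho * (2 * Rabs (ln a) + ln t)) by ring.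
    apply Rmult_le_compat_l; [lra|].
    unfold Rabs; destruct (Rcase_abs (ln t)), (Rcase_abs (ln a)); lra. }
  destruct h as [h|h]; [left; now apply exp_increasing|right; now rewrite h].
Qed.

(* [d] counts the differentiations already performed: each one lowers [N] by one. *)
Lemma symbol_exp_rest a z m d :
  0 < a ->
  symbol a (fun N => (/ 2) ^ N) m (growth z)
    (fun N t => Re (exp_rest (N - d) z (- ln t))) /\
  symbol a (fun N => (/ 2) ^ N) m (growth z)
    (fun N t => Im (exp_rest (N - d) z (- ln t))).
Proof.
  intros ha; revert d.
  assert (Hb : forall d, exists C, forall N t, a <= t ->
    Rabs (Re (exp_rest (N - d) z (- ln t))) <= C * (/ 2) ^ N * Rpower t (growth z) /\
    Rabs (Im (exp_rest (N - d) z (- ln t))) <= C * (/ 2) ^ N * Rpower t (growth z)).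
  { intros d; exists (2 ^ d * exp (2 * growth z * Rabs (ln a))); intros N t ht.
    destruct (exp_rest_bound (N - d) z (- ln t)) as [Hr Hi].
    pose proof (exp_abs_ln_bound a (growth z) t (growth_pos z) ltac:(lra)) as He.
    (* Each differentiation costs a factor [2]. If [d > N], the subtraction truncates to [0] and the
       right side is at least [1]. *)
    assert (Hp : (/ 2) ^ (N - d) <= 2 ^ d * (/ 2) ^ N).
    { apply Rle_trans with (2 ^ d * (/ 2) ^ (N - d + d)).
      - rewrite pow_add.
        replace (2 ^ d * ((/ 2) ^ (N - d) * (/ 2) ^ d))
          with ((/ 2) ^ (N - d) * ((2 ^ d) * (/ 2) ^ d)) by ring.
        rewrite <- Rpow_mult_distr, Rinv_r, pow1 by lra; lra.
      - apply Rmult_le_compat_l; [apply pow_le; lra|].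
        destruct (Nat.le_gt_cases d N) as [h|h].
        + replace (N - d + d)%nat with N by lia; lra.
        + replace (N - d + d)%nat with (N + (d - N))%nat by lia.
          rewrite pow_add; apply Rle_trans with ((/ 2) ^ N * 1); [|lra].
          apply Rmult_le_compat_l; [apply pow_le; lra|].
          rewrite <- (pow1 (d - N)); apply pow_incr; lra. }
    pose proof (pow_le (/ 2) (N - d) ltac:(lra)) as Hp0.
    pose proof (exp_pos (growth z * Rabs (- ln t))) as He0.
    pose proof (Rmult_le_compat _ _ _ _ Hp0 (Rlt_le _ _ He0) Hp He) as H.
    split; eapply Rle_trans; eauto; lra. }
  assert (Hd : forall d N t, a <= t ->
    is_derive (fun t => Re (exp_rest (N - d) z (- ln t))) t
      (/ t * (Im z * Im (exp_rest (N - S d) z (- ln t))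
              - Re z * Re (exp_rest (N - S d) z (- ln t)))) /\
    is_derive (fun t => Im (exp_rest (N - d) z (- ln t))) t
      (/ t * (-1 * (Re z * Im (exp_rest (N - S d) z (- ln t))
                    + Im z * Re (exp_rest (N - S d) z (- ln t)))))).
  { intros d N t ht.
    assert (Hl : is_derive (fun t => - ln t) t (- / t))
      by (auto_derive; [lra|field; lra]).
    destruct (is_derive_exp_rest (N - d) z (- ln t)) as [Hr Hi].
    replace (pred (N - d)) with (N - S d)%nat in * by lia.
    pose proof (is_derive_comp (fun L => Re (exp_rest (N - d) z L)) _ _ _ _ Hr Hl) as H1.
    pose proof (is_derive_comp (fun L => Im (exp_rest (N - d) z L)) _ _ _ _ Hi Hl) as H2.
    split; [eapply is_derive_ext_loc, (eq_ind _ (fun y => is_derive _ t y) H1)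
           |eapply is_derive_ext_loc, (eq_ind _ (fun y => is_derive _ t y) H2)];
      try (apply filter_forall; intros; reflexivity);
      unfold scal; simpl; unfold mult; simpl; unfold Re, Im; ring. }
  induction m as [|m IH]; intros d; destruct (Hb d) as [C HC].
  - split; (split; [exists C; intros N t ht; now apply HC|easy]).
  - destruct (IH (S d)) as [IHr IHi]; split.
    + apply (symbol_intro _ _ _ _ _ _ (fun N t => Im z * Im (exp_rest (N - S d) z (- ln t))
              - Re z * Re (exp_rest (N - S d) z (- ln t)))); [easy| | |].
      * exists C; intros N t ht; now apply HC.
      * intros N t ht; now apply Hd.
      * now apply symbol_minus; [| apply symbol_scal ..].
    + apply (symbol_intro _ _ _ _ _ _ (fun N t =>
              -1 * (Re z * Im (exp_rest (N - S d) z (- ln t))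
                    + Im z * Re (exp_rest (N - S d) z (- ln t))))); [easy| | |].
      * exists C; intros N t ht; now apply HC.
      * intros N t ht; now apply Hd.
      * now apply symbol_scal, symbol_plus; apply symbol_scal.
Qed.

(** * The analytic continuation *)

Definition euler_csum (u : nat -> C) (l : C) : Prop :=
  euler_sum (fun k => Re (u k)) (Re l) /\ euler_sum (fun k => Im (u k)) (Im l).

Lemma C_ext (u v : C) : Re u = Re v -> Im u = Im v -> u = v.
Proof. destruct u, v; simpl; intros; now f_equal. Qed.

Lemma euler_csum_unique u l l' : euler_csum u l -> euler_csum u l' -> l = l'.
Proof.
  intros [Hr Hi] [Hr' Hi']; apply C_ext; eapply euler_sum_unique; eauto.
Qed.

Lemma euler_csum_ext (u v : nat -> C) l :
  (forall k, u k = v k) -> euler_csum u l -> euler_csum v l.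
Proof.
  intros E [Hr Hi]; split; eapply euler_sum_ext; eauto; intros k; simpl;
    now rewrite E.
Qed.

Lemma euler_csum_minus u v l l' :
  euler_csum u l -> euler_csum v l' -> euler_csum (fun k => u k - v k)%C (l - l')%C.
Proof.
  intros [Hr Hi] [Hr' Hi']; split.
  - exact (euler_sum_minus _ _ _ _ Hr Hr').
  - exact (euler_sum_minus _ _ _ _ Hi Hi').
Qed.

Lemma euler_csum_scal c u l :
  euler_csum u l -> euler_csum (fun k => c * u k)%C (c * l)%C.
Proof.
  intros [Hr Hi]; split; simpl.
  - exact (euler_sum_minus _ _ _ _ (euler_sum_scal (Re c) _ _ Hr)
             (euler_sum_scal (Im c) _ _ Hi)).
  - exact (euler_sum_plus _ _ _ _ (euler_sum_scal (Re c) _ _ Hi)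
             (euler_sum_scal (Im c) _ _ Hr)).
Qed.

Lemma filterlim_C_components (v : nat -> C) (l : C) :
  is_lim_seq (fun n => Re (v n)) (Re l) -> is_lim_seq (fun n => Im (v n)) (Im l) ->
  filterlim v eventually (locally (T := C_UniformSpace) l).
Proof.
  intros Hr Hi; apply filterlim_locally; intros eps.
  pose proof (proj1 (filterlim_locally _ _) Hr eps) as [N1 H1].
  pose proof (proj1 (filterlim_locally _ _) Hi eps) as [N2 H2].
  exists (N1 + N2)%nat; intros n Hn; split.
  - apply H1; lia.
  - apply H2; lia.
Qed.

(** The components of [t^(-s0)] are symbols of order [- Re s0], those of the remainders have order
    [growth z] and weight [(1/2)^N]. The products thus have an order independent of [N], and the
    weight passes to the sums. *)
Lemma euler_csum_exp_rest a s0 z :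
  0 < a ->
  exists (l : nat -> C) B, forall N,
    euler_csum (fun k => Cpower (INR k + a) (- s0)
                         * exp_rest N z (- ln (INR k + a)))%C (l N) /\
    Rabs (Re (l N)) <= B * (/ 2) ^ N /\ Rabs (Im (l N)) <= B * (/ 2) ^ N.
Proof.
  intros ha; destruct s0 as [x y].
  assert (H : forall c d m,
    symbol a (fun _ : unit => 1) m (- x) (fun _ => c) ->
    symbol a (fun _ : unit => 1) m (- x) (fun _ => d) ->
    symbol a (fun N => (/ 2) ^ N) m (- x + growth z)
      (fun N t => c t * Re (exp_rest N z (- ln t)) - d t * Im (exp_rest N z (- ln t)))
    /\
    symbol a (fun N => (/ 2) ^ N) m (- x + growth z)
      (fun N t => c t * Im (exp_rest N z (- ln t)) + d t * Re (exp_rest N z (- ln t)))).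
  { intros c d m Hc Hd.
    destruct (symbol_exp_rest a z m 0 ha) as [Hr Hi].
    assert (Hr' : symbol a (fun N => (/ 2) ^ N) m (growth z)
                    (fun N t => Re (exp_rest N z (- ln t)))).
    { refine (symbol_ext _ ha _ _ _ _ _ _ _ Hr); intros N t _.
      now rewrite Nat.sub_0_r. }
    assert (Hi' : symbol a (fun N => (/ 2) ^ N) m (growth z)
                    (fun N t => Im (exp_rest N z (- ln t)))).
    { refine (symbol_ext _ ha _ _ _ _ _ _ _ Hi); intros N t _.
      now rewrite Nat.sub_0_r. }
    split; [apply symbol_minus | apply symbol_plus];
      try easy; now apply symbol_mult. }
  destruct (symbol_euler_sum a ha _ _ _ _
    (fun m => proj1 (H _ _ m (proj1 (symbol_trig a (- x) (- y) m ha))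
                             (proj2 (symbol_trig a (- x) (- y) m ha)))))
    as [lr [B Hr]].
  destruct (symbol_euler_sum a ha _ _ _ _
    (fun m => proj2 (H _ _ m (proj1 (symbol_trig a (- x) (- y) m ha))
                             (proj2 (symbol_trig a (- x) (- y) m ha)))))
    as [li [D Hi]].
  exists (fun N => (lr N, li N)), (Rabs B + Rabs D); intros N.
  destruct (Hr N) as [Sr Br], (Hi N) as [Si Bi].
  pose proof (pow_le (/ 2) N ltac:(lra)).
  pose proof (Rle_abs B); pose proof (Rle_abs D).
  pose proof (Rabs_pos B); pose proof (Rabs_pos D).
  repeat split.
  - refine (euler_sum_ext _ _ _ _ Sr); intros k.
    change (- (x, y))%C with (- x, - y); now rewrite Cpower_trig.
  - refine (euler_sum_ext _ _ _ _ Si); intros k.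
    change (- (x, y))%C with (- x, - y); now rewrite Cpower_trig.
  - simpl; nra.
  - simpl; nra.
Qed.

(** For [z = 1], consecutive remainders differ exactly by the Taylor term [(- ln t)^n / n!]. *)
Lemma euler_csum_log_power a s0 n :
  0 < a ->
  exists c, euler_csum (fun k => Cpower (INR k + a) (- s0)
                * RtoC ((- ln (INR k + a)) ^ n / INR (fact n)))%C c.
Proof.
  intros ha; destruct (euler_csum_exp_rest a s0 (RtoC 1) ha) as [l [B Hl]].
  exists (l n - l (S n))%C.
  refine (euler_csum_ext _ _ _ _
            (euler_csum_minus _ _ _ _ (proj1 (Hl n)) (proj1 (Hl (S n))))).
  intros k; cbn [exp_rest].
  assert (E : pow_n (K := C_Ring) (RtoC 1) n = RtoC 1).
  { clear; induction n as [|n IH]; [reflexivity|].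
    change (RtoC 1 * pow_n (K := C_Ring) (RtoC 1) n = RtoC 1)%C.
    rewrite IH; ring. }
  rewrite E; ring.
Qed.

Lemma euler_csum_Cpower a s :
  0 < a -> exists l, euler_csum (fun k => Cpower (INR k + a) (- s)) l.
Proof.
  intros ha; destruct (euler_csum_log_power a s 0 ha) as [l Hl]; exists l.
  refine (euler_csum_ext _ _ _ _ Hl); intros k; simpl.
  rewrite Rdiv_1_r; ring.
Qed.

Definition euler_zeta (a : R) (s : C) : C :=
  epsilon (inhabits (RtoC 0)) (euler_csum (fun k => Cpower (INR k + a) (- s))).

Lemma euler_zeta_spec a s :
  0 < a -> euler_csum (fun k => Cpower (INR k + a) (- s)) (euler_zeta a s).
Proof.
  intros ha; unfold euler_zeta; apply epsilon_spec, euler_csum_Cpower, ha.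
Qed.

Lemma is_lim_seq_geom_bound (u : nat -> R) B :
  (forall n, Rabs (u n) <= B * (/ 2) ^ n) -> is_lim_seq u 0.
Proof.
  intros H; apply is_lim_seq_abs_0.
  apply is_lim_seq_le_le with (fun _ => 0) (fun n => B * (/ 2) ^ n).
  - intros n; split; [apply Rabs_pos|apply H].
  - apply is_lim_seq_const.
  - replace (Finite 0) with (Rbar_mult B 0) by (simpl; f_equal; ring).
    apply is_lim_seq_scal_l, is_lim_seq_geom.
    rewrite Rabs_pos_eq; lra.
Qed.

(** The coefficients are the Euler sums of the Taylor coefficients of [(k+a)^(-s)] at [s0]. By
    linearity the partial sums miss the value by the Euler sum of the remainders, which decays like
    [(1/2)^n] for every [s], so any radius would do. *)
Lemma entire_euler_zeta a : 0 < a -> entire (euler_zeta a).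
Proof.
  intros ha s0.
  destruct (choice _ (fun n => euler_csum_log_power a s0 n ha)) as [c Hc].
  exists c, (mkposreal 1 Rlt_0_1); intros s _.
  set (z := (s - s0)%C).
  destruct (euler_csum_exp_rest a s0 z ha) as [l [B Hl]].
  assert (H0 : l O = euler_zeta a s).
  { apply (euler_csum_unique (fun k => Cpower (INR k + a) (- s))).
    - refine (euler_csum_ext _ _ _ _ (proj1 (Hl O))); intros k; simpl.
      unfold Cpower; rewrite <- Cexp_plus; f_equal.
      rewrite RtoC_opp; unfold z; ring.
    - now apply euler_zeta_spec. }
  assert (HS : forall n, l (S n) = (l n - pow_n (K := C_Ring) z n * c n)%C).
  { intros n.
    apply (euler_csum_unique _ _ _ (proj1 (Hl (S n)))).
    refine (euler_csum_ext _ _ _ _ (euler_csum_minus _ _ _ _ (proj1 (Hl n))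
              (euler_csum_scal (pow_n (K := C_Ring) z n) _ _ (Hc n)))).
    intros k; cbn [exp_rest]; ring. }
  assert (Hsum : forall n,
    sum_n (G := C_AbelianMonoid) (fun k => scal (pow_n (K := C_Ring) z k) (c k)) n
    = (euler_zeta a s - l (S n))%C).
  { induction n as [|n IH].
    - rewrite sum_O, HS, H0.
      change (pow_n (K := C_Ring) z 0 * c O
              = euler_zeta a s - (euler_zeta a s - pow_n (K := C_Ring) z 0 * c O)
              :> C)%C; ring.
    - rewrite sum_Sn, IH, (HS (S n)).
      change (euler_zeta a s - l (S n) + pow_n (K := C_Ring) z (S n) * c (S n)
              = euler_zeta a s - (l (S n) - pow_n (K := C_Ring) z (S n) * c (S n))
              :> C)%C; ring. }
  assert (Hlim : forall f : C -> R, f = Re \/ f = Im ->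
    is_lim_seq (fun n => f (l (S n))) 0).
  { intros f Hf; apply (is_lim_seq_incr_1 (fun n => f (l n))).
    apply is_lim_seq_geom_bound with B; intros n.
    destruct Hf as [-> | ->]; apply Hl. }
  apply filterlim_C_components.
  - apply is_lim_seq_ext with (fun n => Re (euler_zeta a s) - Re (l (S n))).
    + intros n; exact (eq_sym (f_equal Re (Hsum n))).
    + replace (Finite (Re _)) with (Finite (Re (euler_zeta a s) - 0))
        by (f_equal; ring).
      apply is_lim_seq_minus'; [apply is_lim_seq_const|apply Hlim; auto].
  - apply is_lim_seq_ext with (fun n => Im (euler_zeta a s) - Im (l (S n))).
    + intros n; exact (eq_sym (f_equal Im (Hsum n))).
    + replace (Finite (Im _)) with (Finite (Im (euler_zeta a s) - 0))
        by (f_equal; ring).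
      apply is_lim_seq_minus'; [apply is_lim_seq_const|apply Hlim; auto].
Qed.

Lemma is_lim_seq_Rpower_neg a p :
  0 < a -> p < 0 -> is_lim_seq (fun k => Rpower (INR k + a) p) 0.
Proof.
  intros ha hp.
  assert (Hl : is_lim_seq (fun k => ln (INR k + a)) p_infty).
  { apply (is_lim_comp_seq ln (fun k => INR k + a) p_infty p_infty).
    - apply is_lim_ln_p.
    - now exists O.
    - apply is_lim_seq_le_p_loc with INR; [|apply is_lim_seq_INR].
      exists O; intros n _; lra. }
  apply (is_lim_comp_seq exp (fun k => p * ln (INR k + a)) m_infty 0).
  - apply is_lim_exp_m.
  - now exists O.
  - replace m_infty with (Rbar_mult p p_infty).
    + now apply is_lim_seq_scal_l.
    + simpl; destruct (Rle_dec 0 p); [exfalso; lra|easy].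
Qed.

(** For [Re s > 0] the terms tend to zero, and there Euler summation gives the ordinary sum. *)
Lemma is_alt_zeta_euler_zeta a : 0 < a -> is_alt_zeta a (euler_zeta a).
Proof.
  intros ha; split; [now apply entire_euler_zeta|].
  intros s hs; destruct (euler_zeta_spec a s ha) as [Sr Si].
  assert (Hlim : forall f : R -> R, (forall v, Rabs (f v) <= 1) ->
    is_lim_seq (fun k => exp (- Re s * ln (INR k + a)) * f (- Im s * ln (INR k + a))) 0).
  { intros f Hf; apply is_lim_seq_abs_0.
    apply is_lim_seq_le_le with (fun _ => 0) (fun k => Rpower (INR k + a) (- Re s)).
    - intros k; split; [apply Rabs_pos|].
      rewrite Rabs_mult, Rabs_pos_eq by (left; apply exp_pos).
      specialize (Hf (- Im s * ln (INR k + a))).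
      pose proof (exp_pos (- Re s * ln (INR k + a))); unfold Rpower; nra.
    - apply is_lim_seq_const.
    - apply is_lim_seq_Rpower_neg; lra. }
  assert (E : forall t, Cpower t (- s) =
    (exp (- Re s * ln t) * cos (- Im s * ln t), exp (- Re s * ln t) * sin (- Im s * ln t))).
  { intros t; destruct s as [x y]; apply (Cpower_trig t (- x) (- y)). }
  apply euler_sum_series in Sr.
  2:{ refine (is_lim_seq_ext _ _ _ _ (Hlim cos _)).
      - intros k; now rewrite E.
      - intros v; apply Rabs_le, COS_bound. }
  apply euler_sum_series in Si.
  2:{ refine (is_lim_seq_ext _ _ _ _ (Hlim sin _)).
      - intros k; now rewrite E.
      - intros v; apply Rabs_le, SIN_bound. }
  assert (Hsum : forall n, sum_n (G := C_AbelianMonoid)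
      (fun k => RtoC ((-1) ^ k) / Cpower (INR k + a) s)%C n =
    (sum_n (fun k => (-1) ^ k * Re (Cpower (INR k + a) (- s))) n,
     sum_n (fun k => (-1) ^ k * Im (Cpower (INR k + a) (- s))) n)).
  { assert (Et : forall k, (RtoC ((-1) ^ k) / Cpower (INR k + a) s)%C =
      ((-1) ^ k * Re (Cpower (INR k + a) (- s)),
       (-1) ^ k * Im (Cpower (INR k + a) (- s)))).
    { intros k; unfold Cdiv; rewrite <- Cpower_opp.
      apply C_ext; unfold Re, Im; simpl; ring. }
    induction n as [|n IH].
    - now rewrite !sum_O, Et.
    - now rewrite !sum_Sn, IH, Et. }
  apply filterlim_C_components.
  - refine (filterlim_ext _ _ _ Sr); intros n.
    exact (eq_sym (f_equal Re (Hsum n))).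
  - refine (filterlim_ext _ _ _ Si); intros n.
    exact (eq_sym (f_equal Im (Hsum n))).
Qed.

(** * Uniqueness on the real axis *)

(** Convergence at [r / 2] makes the radius positive, so the sum is continuous at [0], with value
    [c O] there and limit [0] from the right. *)
Lemma pseries_right_zero_coef0 (c : nat -> R) r :
  0 < r -> (forall x, 0 < x < r -> is_pseries c x 0) -> c O = 0.
Proof.
  intros hr H.
  assert (Hr : Rbar_lt (Rabs 0) (CV_radius c)).
  { rewrite Rabs_R0.
    apply Rbar_lt_le_trans with (Finite (r / 2)); [simpl; lra|].
    apply Rbar_not_lt_le; intros hlt.
    apply (CV_disk_outside c (r / 2)); [now rewrite Rabs_pos_eq by lra|].
    apply ex_series_lim_0; exists 0; apply is_pseries_R, H; lra. }
  pose proof (PSeries_continuity c 0 Hr) as Hc.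
  apply continuity_pt_filterlim in Hc; rewrite PSeries_0 in Hc.
  assert (Hz : filterlim (PSeries c) (at_right 0) (locally 0)).
  { apply filterlim_ext_loc with (fun _ => 0); [|apply filterlim_const].
    exists (mkposreal r hr); intros y Hy h0; symmetry.
    apply is_pseries_unique, H; split; [easy|].
    change (Rabs (y - 0) < r) in Hy.
    apply Rabs_def2 in Hy; lra. }
  apply (filterlim_locally_unique (F := at_right 0) (PSeries c)); [|easy].
  intros P HP; specialize (Hc P HP); destruct Hc as [e He]; exists e; auto.
Qed.

Lemma pseries_right_zero (c : nat -> R) r :
  0 < r -> (forall x, 0 < x < r -> is_pseries c x 0) -> forall n, c n = 0.
Proof.
  intros hr H n; revert c H; induction n as [|n IH]; intros c H;
    pose proof (pseries_right_zero_coef0 c r hr H) as H0; [easy|].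
  apply (IH (PS_decr_1 c)); intros x hx.
  replace 0 with (scal (/ x) (plus 0 (opp (c O)))).
  - apply (is_pseries_decr_1 c x (/ x)); [|now apply H].
    change (/ x * x = 1); field; lra.
  - rewrite H0; unfold scal, plus, opp; simpl; unfold mult; simpl; ring.
Qed.

Definition real_analytic (f : R -> R) : Prop :=
  forall x0, exists (c : nat -> R) r, 0 < r /\
    forall x, Rabs (x - x0) < r -> is_pseries c (x - x0) (f x).

(** At the supremum [b] of the points where [f] does not vanish, the local power series is zero to
    the right, hence identically. Then [f] also vanishes just to the left of [b], against the choice
    of [b]. *)
Lemma real_analytic_zero f :
  real_analytic f -> (forall x, 0 < x -> f x = 0) -> forall x, f x = 0.
Proof.
  intros Hf H0 x1; apply NNPP; intros Hx1.
  destruct (completeness (fun x => f x <> 0)) as [b [Hub Hlub]].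
  - exists 0; intros x Hx; destruct (Rle_lt_dec x 0) as [h|h]; [easy|].
    now elim Hx; apply H0.
  - now exists x1.
  - assert (Hb : forall x, b < x -> f x = 0).
    { intros x Hx; apply NNPP; intros Hn; specialize (Hub x Hn); lra. }
    destruct (Hf b) as [c [r [hr Hc]]].
    assert (Hc0 : forall n, c n = 0).
    { apply (pseries_right_zero c r hr); intros x hx.
      rewrite <- (Hb (b + x)) by lra.
      replace x with (b + x - b) at 1 by ring.
      apply Hc; rewrite Rabs_pos_eq; lra. }
    assert (Hle : b <= b - r); [|lra].
    apply Hlub; intros x Hx; apply Rnot_lt_le; intros hlt; apply Hx.
    destruct (Rlt_le_dec b x) as [h|h]; [now apply Hb|].
    rewrite <- (is_pseries_unique c (x - b) (f x)) by (apply Hc; apply Rabs_def1; lra).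
    rewrite <- (PSeries_const_0 (x - b)); now apply PSeries_ext.
Qed.

Lemma is_pseries_C_real (c : nat -> C) x l :
  is_pseries (K := C_AbsRing) (V := C_NormedModule) c (RtoC x) l ->
  is_pseries (fun n => Re (c n)) x (Re l) /\ is_pseries (fun n => Im (c n)) x (Im l).
Proof.
  intros H.
  assert (Hp : forall n, pow_n (K := C_Ring) (RtoC x) n = RtoC (x ^ n)).
  { induction n as [|n IH]; [reflexivity|].
    change (RtoC x * pow_n (K := C_Ring) (RtoC x) n = RtoC (x * x ^ n))%C.
    now rewrite IH, RtoC_mult. }
  assert (Hs : forall n, sum_n (G := C_AbelianMonoid)
      (fun k => scal (pow_n (K := C_Ring) (RtoC x) k) (c k)) n =
    (sum_n (fun k => Re (c k) * x ^ k) n, sum_n (fun k => Im (c k) * x ^ k) n)).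
  { assert (Et : forall k, scal (pow_n (K := C_Ring) (RtoC x) k) (c k) =
      (Re (c k) * x ^ k, Im (c k) * x ^ k)).
    { intros k; rewrite Hp.
      change (Cmult (RtoC (x ^ k)) (c k) = (Re (c k) * x ^ k, Im (c k) * x ^ k)).
      apply C_ext; unfold Re, Im; simpl; ring. }
    induction n as [|n IH]; [now rewrite !sum_O, Et|now rewrite !sum_Sn, IH, Et]. }
  unfold is_pseries, is_series in H.
  split; apply is_pseries_R; intros P [e He];
    destruct (H (fun v => ball l e v) (locally_ball l e)) as [N HN];
    exists N; intros n Hn; apply He; specialize (HN n Hn);
    pose proof (eq_ind _ (fun v : C => ball (M := C_UniformSpace) l e v) HN _ (Hs n)) as HB;
    apply HB.
Qed.

(** The real axis suffices because the expansion evaluates [alt_zeta] only at real points; there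
    real and imaginary parts reduce the identity theorem to real power series. *)
Lemma is_alt_zeta_unique_real a Z W (s : R) :
  is_alt_zeta a Z -> is_alt_zeta a W -> Z (RtoC s) = W (RtoC s).
Proof.
  intros [HZ SZ] [HW SW].
  assert (H0 : forall x, 0 < x -> Z (RtoC x) = W (RtoC x)).
  { intros x hx; apply (filterlim_locally_unique _ _ _ (SZ (RtoC x) hx) (SW (RtoC x) hx)). }
  assert (Han : forall x0 : R, exists (c d : nat -> R) r, 0 < r /\
    forall x, Rabs (x - x0) < r ->
      is_pseries c (x - x0) (Re (Z (RtoC x)) - Re (W (RtoC x))) /\
      is_pseries d (x - x0) (Im (Z (RtoC x)) - Im (W (RtoC x)))).
  { intros x0; destruct (HZ (RtoC x0)) as [c [r Hc]], (HW (RtoC x0)) as [d [q Hd]].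
    exists (PS_minus (fun n => Re (c n)) (fun n => Re (d n))),
      (PS_minus (fun n => Im (c n)) (fun n => Im (d n))), (Rmin r q).
    split; [apply Rmin_glb_lt; apply cond_pos|]; intros x hx.
    assert (E : (RtoC x - RtoC x0)%C = RtoC (x - x0)) by now rewrite RtoC_minus.
    pose proof (Rmin_l r q); pose proof (Rmin_r r q).
    assert (Hc' := Hc (RtoC x)); assert (Hd' := Hd (RtoC x)).
    rewrite E, Cmod_R in Hc', Hd'.
    destruct (is_pseries_C_real _ _ _ (Hc' ltac:(lra))) as [Cr Ci].
    destruct (is_pseries_C_real _ _ _ (Hd' ltac:(lra))) as [Dr Di].
    split; now apply (is_pseries_minus (K := R_AbsRing) (V := R_NormedModule)). }
  apply C_ext; apply Rminus_diag_uniq.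
  - apply (real_analytic_zero (fun x => Re (Z (RtoC x)) - Re (W (RtoC x)))).
    + intros x0; destruct (Han x0) as [c [d [r [hr H]]]]; exists c, r.
      split; [easy|]; intros x hx; now apply H.
    + intros x hx; rewrite H0 by easy; ring.
  - apply (real_analytic_zero (fun x => Im (Z (RtoC x)) - Im (W (RtoC x)))).
    + intros x0; destruct (Han x0) as [c [d [r [hr H]]]]; exists d, r.
      split; [easy|]; intros x hx; now apply H.
    + intros x hx; rewrite H0 by easy; ring.
Qed.

Lemma euler_sum_alt_zeta a (s : R) :
  0 < a ->
  exists l : R, alt_zeta a (RtoC s) = RtoC l /\
    euler_sum (fun k => Rpower (INR k + a) (- s)) l.
Proof.
  intros ha.
  assert (E : alt_zeta a (RtoC s) = euler_zeta a (RtoC s)).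
  { apply (is_alt_zeta_unique_real a); [|now apply is_alt_zeta_euler_zeta].
    unfold alt_zeta; apply epsilon_spec.
    exists (euler_zeta a); now apply is_alt_zeta_euler_zeta. }
  destruct (euler_zeta_spec a (RtoC s) ha) as [Hr Hi].
  assert (Er : forall k, Cpower (INR k + a) (- RtoC s) = RtoC (Rpower (INR k + a) (- s)))
    by (intros k; now rewrite <- RtoC_opp, Cpower_real).
  (* All imaginary parts of the terms vanish, so scaling by [0] leaves them unchanged and exhibits
     [0] as their Euler sum. *)
  assert (Hi0 : Im (euler_zeta a (RtoC s)) = 0).
  { apply (euler_sum_unique _ _ _ Hi).
    pose proof (euler_sum_scal 0 _ _ Hi) as H0; rewrite Rmult_0_l in H0.
    refine (euler_sum_ext _ _ _ _ H0); intros k; rewrite Er; simpl; ring. }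
  exists (Re (euler_zeta a (RtoC s))); split.
  - rewrite E; now apply C_ext.
  - refine (euler_sum_ext _ _ _ _ Hr); intros k; now rewrite Er.
Qed.

(** * The functional equation of Gamma *)

(** Integrals of the positive [f] grow with the interval and are bounded by increments of [F], so
    their supremum is the improper integral at both ends at once. *)
Lemma is_RInt_gen_pos_bounded (f F f1 : R -> R) K :
  (forall t, 0 < t -> continuous f t) -> (forall t, 0 < t -> 0 < f t <= f1 t) ->
  (forall t, 0 < t -> is_derive F t (f1 t)) -> (forall t, 0 < t -> continuous f1 t) ->
  (forall t, 0 < t -> 0 <= F t <= K) ->
  exists G, 0 < G /\ is_RInt_gen f (at_right 0) (Rbar_locally p_infty) G.
Proof.
  intros Hc Hf Hd Hc1 HF.
  assert (Hex : forall g a b, (forall t, 0 < t -> continuous g t) ->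
    0 < a -> 0 < b -> ex_RInt (V := R_CompleteNormedModule) g a b).
  { intros g a b Hg ha hb; apply ex_RInt_continuous; intros t [ht _].
    apply Hg; apply Rlt_le_trans with (2 := ht); now apply Rmin_glb_lt. }
  assert (Hub : forall a b, 0 < a <= b -> RInt f a b <= K).
  { intros a b hab; apply Rle_trans with (RInt f1 a b).
    - apply RInt_le; [lra|apply Hex; [easy|lra..]|apply Hex; [easy|lra..]|].
      intros t ht; apply Hf; lra.
    - rewrite (is_RInt_unique f1 a b (minus (F b) (F a))).
      + unfold minus, plus, opp; simpl.
        pose proof (HF a ltac:(lra)); pose proof (HF b ltac:(lra)); lra.
      + apply (is_RInt_derive (V := R_CompleteNormedModule));
          intros t; rewrite Rmin_left by lra; intros ht; [apply Hd|apply Hc1]; lra. }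
  assert (Hmono : forall a b a' b', 0 < a' <= a -> a <= b -> b <= b' ->
                  RInt f a b <= RInt f a' b').
  { intros a b a' b' ha hab hb.
    rewrite <- (RInt_Chasles f a' a b') by (apply Hex; [easy|lra..]).
    rewrite <- (RInt_Chasles f a b b') by (apply Hex; [easy|lra..]).
    unfold plus; simpl.
    assert (0 <= RInt f a' a).
    { apply RInt_ge_0; [lra|apply Hex; [easy|lra..]|].
      intros t ht; left; apply Hf; lra. }
    assert (0 <= RInt f b b').
    { apply RInt_ge_0; [lra|apply Hex; [easy|lra..]|].
      intros t ht; left; apply Hf; lra. }
    lra. }
  destruct (completeness (fun v => exists a b, 0 < a <= b /\ v = RInt f a b))
    as [G [HGub HGlub]].
  - exists K; intros v [a [b [hab ->]]]; auto.
  - exists (RInt f 1 1), 1, 1; split; [lra|easy].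
  - exists G; split.
    + apply Rlt_le_trans with (RInt f 1 2).
      * apply RInt_gt_0; [lra| |]; intros t ht; [apply Hf|apply Hc]; lra.
      * apply HGub; exists 1, 2; split; [lra|easy].
    + intros P [e HP].
      assert (H : exists a b, 0 < a <= b /\ G - e < RInt f a b).
      { apply NNPP; intros Hn.
        assert (G <= G - e); [|pose proof (cond_pos e); lra].
        apply HGlub; intros v [a [b [hab ->]]]; apply Rnot_lt_le; intros hlt.
        apply Hn; now exists a, b. }
      destruct H as [a [b [hab hG]]].
      apply (Filter_prod _ _ _ (fun u => 0 < u < a) (fun v => b < v)).
      * exists (mkposreal a ltac:(lra)); intros u Hu hu; split; [easy|].
        change (Rabs (u - 0) < a) in Hu.
        apply Rabs_def2 in Hu; lra.
      * now exists b.
      * intros u v hu hv; exists (RInt f u v); split.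
        -- apply (RInt_correct (V := R_CompleteNormedModule) f), Hex; [easy|simpl; lra..].
        -- apply HP.
           assert (h1 : RInt f u v <= G)
             by (apply HGub; exists u, v; split; [lra|easy]).
           pose proof (Hmono a b u v ltac:(lra) ltac:(lra) ltac:(lra)) as h2.
           change (Rabs (RInt f u v - G) < e).
           apply Rabs_def1; lra.
Qed.

(** This is [ln y <= y] at [y = t / (2 z)], multiplied by [z]. *)
Lemma Rpower_exp_bound z t :
  0 < z -> 0 < t -> Rpower t z <= exp (z * ln (2 * z)) * exp (t / 2).
Proof.
  intros hz ht; unfold Rpower; rewrite <- exp_plus.
  assert (h : z * ln t <= z * ln (2 * z) + t / 2).
  { assert (hy : 0 < t / (2 * z)) by (apply Rdiv_lt_0_compat; lra).
    assert (hl : ln (t / (2 * z)) <= t / (2 * z)).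
    { pose proof (exp_ineq1_le (ln (t / (2 * z)))) as h.
      rewrite exp_ln in h by easy; lra. }
    rewrite ln_div in hl by lra.
    apply Rplus_le_reg_r with (- (z * ln (2 * z))).
    replace (z * ln t + - _) with (z * (ln t - ln (2 * z))) by ring.
    apply Rle_trans with (z * (t / (2 * z))); [apply Rmult_le_compat_l; lra|].
    right; field; lra. }
  destruct h as [h|h]; [left; now apply exp_increasing|right; now rewrite h].
Qed.

Lemma continuous_Rpower p t : 0 < t -> continuous (fun t => Rpower t p) t.
Proof.
  intros ht; apply (ex_derive_continuous (fun t => Rpower t p)).
  eexists; now apply is_derive_Rpower.
Qed.

(** One majorant with a bounded primitive serves both ends: [C t^(z-1) / (1 + t^z)^2]. *)
Lemma is_RInt_gen_Gamma z :
  0 < z -> exists G, 0 < G /\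
    is_RInt_gen (fun t => Rpower t (z - 1) * exp (- t))
      (at_right 0) (Rbar_locally p_infty) G.
Proof.
  intros hz; set (K := exp (z * ln (2 * z))).
  assert (hK : 0 < K) by apply exp_pos.
  (* Chosen so that [(1 + t^z)^2 <= C e^t], from [1 + t^z <= (1 + K) e^(t/2)]. *)
  set (C := (1 + K) ^ 2).
  assert (hC : 0 < C) by (apply pow_lt; lra).
  assert (Hd : forall t, 0 < t -> is_derive (fun t => Rpower t z) t (z * Rpower t (z - 1)))
    by (intros; now apply is_derive_Rpower).
  apply (is_RInt_gen_pos_bounded _ (fun t => C / z * (1 - / (1 + Rpower t z)))
           (fun t => C * Rpower t (z - 1) / (1 + Rpower t z) ^ 2) (C / z)).
  - intros t ht; apply (continuous_mult (K := R_AbsRing)); [now apply continuous_Rpower|].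
    apply (ex_derive_continuous (fun t => exp (- t))); auto_derive; easy.
  - intros t ht; split; [apply Rmult_lt_0_compat; apply exp_pos|].
    pose proof (exp_pos (z * ln t)) as hp; fold (Rpower t z) in hp.
    unfold Rdiv; rewrite (Rmult_comm C), Rmult_assoc.
    apply Rmult_le_compat_l; [left; apply exp_pos|].
    apply Rle_div_r; [apply pow_lt; lra|].
    rewrite exp_Ropp, Rmult_comm; apply Rle_div_l; [apply exp_pos|].
    replace (exp t) with (exp (t / 2) ^ 2)
      by (simpl; rewrite Rmult_1_r, <- exp_plus; f_equal; field).
    unfold C; rewrite <- Rpow_mult_distr; apply pow_incr; split; [lra|].
    pose proof (Rpower_exp_bound z t hz ht) as hb; fold K in hb.
    pose proof (exp_ineq1_le (t / 2)); lra.
  - intros t ht; pose proof (exp_pos (z * ln t)) as hp; fold (Rpower t z) in hp.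
    replace (C * _ / _) with (scal (z * Rpower t (z - 1)) (C / z / (1 + Rpower t z) ^ 2))
      by (unfold scal; simpl; unfold mult; simpl; field; lra).
    apply (is_derive_comp (fun y => C / z * (1 - / (1 + y))) (fun t => Rpower t z));
      [|now apply Hd].
    auto_derive; [lra|simpl; field; lra].
  - intros t ht; pose proof (exp_pos (z * ln t)) as hp; fold (Rpower t z) in hp.
    apply (continuous_mult (K := R_AbsRing) (fun t => C * Rpower t (z - 1))
             (fun t => / (1 + Rpower t z) ^ 2)).
    + apply (continuous_scal_r (V := R_NormedModule) C), continuous_Rpower, ht.
    + apply (continuous_comp (fun t => Rpower t z) (fun y => / (1 + y) ^ 2));
        [now apply continuous_Rpower|].
      apply (ex_derive_continuous (fun y => / (1 + y) ^ 2)); auto_derive.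
      assert (0 < (1 + Rpower t z) ^ 2) by (apply pow_lt; lra); simpl in *; lra.
  - intros t ht; pose proof (exp_pos (z * ln t)) as hp; fold (Rpower t z) in hp.
    assert (hi : 0 < / (1 + Rpower t z) <= 1).
    { split; [apply Rinv_0_lt_compat; lra|].
      rewrite <- Rinv_1; apply Rinv_le_contravar; lra. }
    assert (0 < C / z) by (apply Rdiv_lt_0_compat; lra).
    split; nra.
Qed.

Lemma Gamma_correct z :
  0 < z ->
  is_RInt_gen (fun t => Rpower t (z - 1) * exp (- t))
    (at_right 0) (Rbar_locally p_infty) (Gamma z).
Proof.
  intros hz; destruct (is_RInt_gen_Gamma z hz) as [G [_ H]].
  now rewrite <- (is_RInt_gen_unique (V := R_CompleteNormedModule) _ G H) in H at 1.
Qed.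

Lemma Gamma_pos z : 0 < z -> 0 < Gamma z.
Proof.
  intros hz; destruct (is_RInt_gen_Gamma z hz) as [G [hG H]].
  unfold Gamma; now rewrite (is_RInt_gen_unique (V := R_CompleteNormedModule) _ G H).
Qed.

(** Integration by parts: the boundary function [F] tends to zero at both ends, so the integral of
    [F'] is [0]. *)
Lemma Gamma_succ z : 0 < z -> Gamma (z + 1) = z * Gamma z.
Proof.
  intros hz.
  set (F := fun t => - (Rpower t z * exp (- t))).
  assert (Hd : forall t, 0 < t ->
    is_derive F t (Rpower t z * exp (- t) - z * (Rpower t (z - 1) * exp (- t)))).
  { intros t ht.
    replace (_ - _) with
      (opp (plus (mult (z * Rpower t (z - 1)) (exp (- t)))
                 (mult (Rpower t z) (- exp (- t)))))
      by (unfold opp, plus, mult; simpl; ring).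
    apply (is_derive_opp (fun t => Rpower t z * exp (- t))).
    apply (is_derive_mult (fun t => Rpower t z) (fun t => exp (- t)));
      [now apply is_derive_Rpower|auto_derive; [easy|ring]|intros; apply Rmult_comm]. }
  assert (HD : forall t, 0 < t -> Derive F t =
    Rpower t z * exp (- t) - z * (Rpower t (z - 1) * exp (- t)))
    by (intros; now apply is_derive_unique, Hd).
  assert (Hprod : forall P : R -> Prop, (forall t, 0 < t -> P t) ->
    filter_prod (at_right 0) (Rbar_locally p_infty)
      (fun ab => forall t, Rmin (fst ab) (snd ab) <= t <= Rmax (fst ab) (snd ab) -> P t)).
  { intros P HP; apply (Filter_prod _ _ _ (fun u => 0 < u) (fun v => 0 < v)).
    - exists (mkposreal 1 Rlt_0_1); now intros.
    - now exists 0.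
    - intros u v hu hv t [ht _]; apply HP.
      apply Rlt_le_trans with (2 := ht); now apply Rmin_glb_lt. }
  assert (HI : is_RInt_gen (Derive F) (at_right 0) (Rbar_locally p_infty) (0 - 0)).
  { apply is_RInt_gen_Derive.
    - apply Hprod; intros t ht; eexists; now apply Hd.
    - apply Hprod; intros t ht.
      apply (continuous_ext_loc _
        (fun t => Rpower t z * exp (- t) - z * (Rpower t (z - 1) * exp (- t)))).
      + exists (mkposreal t ht); intros y Hy; symmetry; apply HD.
        change (Rabs (y - t) < t) in Hy.
        apply Rabs_def2 in Hy; lra.
      + assert (He : continuous (fun t => exp (- t)) t)
          by (apply (ex_derive_continuous (fun t => exp (- t))); auto_derive; easy).
        apply (continuous_minus (V := R_NormedModule)
          (fun t => Rpower t z * exp (- t)) (fun t => z * (Rpower t (z - 1) * exp (- t)))).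
        * apply (continuous_mult (K := R_AbsRing)); [now apply continuous_Rpower|easy].
        * apply (continuous_scal_r (V := R_NormedModule) z
                   (fun t => Rpower t (z - 1) * exp (- t))).
          apply (continuous_mult (K := R_AbsRing)); [now apply continuous_Rpower|easy].
    - intros P [e HP].
      exists (mkposreal (Rpower e (/ z)) (exp_pos _)); intros t Ht ht; apply HP.
      change (Rabs (t - 0) < Rpower e (/ z)) in Ht; change (Rabs (F t - 0) < e).
      apply Rabs_def2 in Ht.
      assert (h1 : Rpower t z < e).
      { replace (pos e) with (Rpower (Rpower e (/ z)) z).
        - apply Rlt_Rpower_l; lra.
        - rewrite Rpower_mult, Rinv_l by lra; apply Rpower_1, cond_pos. }
      assert (h2 : exp (- t) < 1) by (rewrite <- exp_0; apply exp_increasing; lra).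
      pose proof (exp_pos (- t)); pose proof (exp_pos (z * ln t)) as h4.
      fold (Rpower t z) in h4.
      unfold F; apply Rabs_def1; nra.
    - change (is_lim F p_infty 0).
      set (K := exp (z * ln (2 * z))).
      (* Half of the exponential decay is spent on [t^z <= K exp (t/2)], the other half forces the
         limit. *)
      apply (is_lim_le_le_loc (fun t => - K * exp (- (/ 2) * t)) (fun _ => 0)).
      + exists 0; intros t ht.
        pose proof (Rpower_exp_bound z t hz ht) as hb; fold K in hb.
        pose proof (exp_pos (- t)) as he; pose proof (exp_pos (z * ln t)) as h4.
        fold (Rpower t z) in h4.
        assert (Eq : exp (t / 2) * exp (- t) = exp (- (/ 2) * t))
          by (rewrite <- exp_plus; f_equal; field).
        unfold F; rewrite <- Eq; split; nra.
      + replace (Finite 0) with (Rbar_mult (- K) 0) by (simpl; f_equal; ring).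
        apply is_lim_scal_l.
        apply (is_lim_comp exp (fun t => - (/ 2) * t) p_infty 0 m_infty).
        * apply is_lim_exp_m.
        * replace m_infty with (Rbar_mult (- / 2) p_infty).
          -- apply is_lim_scal_l, is_lim_id.
          -- simpl; destruct (Rle_dec 0 (- / 2)) as [h|h]; [exfalso; lra|easy].
        * now exists 0.
      + apply is_lim_const. }
  unfold Gamma at 1; apply (is_RInt_gen_unique (V := R_CompleteNormedModule)).
  replace (z * Gamma z) with (plus (0 - 0) (scal z (Gamma z)))
    by (unfold plus, scal; simpl; unfold mult; simpl; ring).
  refine (is_RInt_gen_ext _ _ _ _
    (is_RInt_gen_plus _ _ _ _ HI (is_RInt_gen_scal _ z _ (Gamma_correct z hz)))).
  apply (filter_imp (fun ab => forall t, Rmin (fst ab) (snd ab) <= t <= Rmax (fst ab) (snd ab)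
    -> 0 < t)); [|now apply Hprod].
  intros [u v] H t ht; simpl in *.
  rewrite HD by (apply H; lra).
  unfold plus, scal; simpl; unfold mult; simpl.
  replace (z + 1 - 1) with z by ring; ring.
Qed.

Lemma Gamma_rising mu k : 0 < mu -> Gamma (mu + INR k) / Gamma mu = rising mu k.
Proof.
  intros hmu; pose proof (Gamma_pos mu hmu) as hG.
  induction k as [|k IH].
  - simpl; rewrite Rplus_0_r; field; lra.
  - cbn [rising]; rewrite <- IH, S_INR.
    replace (mu + (INR k + 1)) with (mu + INR k + 1) by ring.
    rewrite Gamma_succ by (pose proof (pos_INR k); lra); field; lra.
Qed.

(** * The expansion *)

Lemma euler_sum_binom_rest a gam alpha mu M :
  0 < a -> 0 < mu ->
  exists (l : posreal -> R) B, forall x : posreal,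
    euler_sum (fun k => Rpower (INR k + a) gam
                        * binom_rest M mu (x * Rpower (INR k + a) alpha)) (l x) /\
    Rabs (l x) <= B * x ^ M.
Proof.
  intros ha hmu.
  apply (symbol_euler_sum a ha _ (fun x : posreal => x ^ M) (gam + alpha * INR M)
    (fun x t => Rpower t gam * binom_rest M mu (x * Rpower t alpha))).
  intros m; apply symbol_mult; [easy|now apply symbol_Rpower|].
  now apply symbol_binom_rest.
Qed.

(** The terms are at most [x^(-mu) t^(gam - alpha mu)] and tend to zero, so their Euler sum is the
    sum of the series defining [alt_g]. *)
Lemma euler_sum_alt_g a gam alpha mu (x : posreal) :
  0 < a -> 0 < mu -> gam < alpha * mu ->
  euler_sum (fun k => Rpower (INR k + a) gam
                      * binom_rest 0 mu (x * Rpower (INR k + a) alpha))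
    (alt_g x a gam alpha mu).
Proof.
  intros ha hmu hgam.
  destruct (euler_sum_binom_rest a gam alpha mu 0 ha hmu) as [l [B Hl]].
  destruct (Hl x) as [H _].
  replace (alt_g x a gam alpha mu) with (l x); [easy|].
  symmetry; apply is_series_unique.
  refine (is_series_ext _ _ _ _ (euler_sum_series _ _ _ H)).
  - intros k; cbn [binom_rest]; rewrite Rpower_Ropp, (Rplus_comm 1).
    unfold Rdiv; symmetry; apply Rmult_assoc.
  - pose proof (cond_pos x) as hx.
    apply is_lim_seq_le_le with (fun _ => 0)
      (fun k => Rpower x (- mu) * Rpower (INR k + a) (gam - alpha * mu)).
    + intros k; cbn [binom_rest]; set (t := INR k + a).
      pose proof (exp_pos (alpha * ln t)) as ht; fold (Rpower t alpha) in ht.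
      assert (hu : 0 < x * Rpower t alpha) by now apply Rmult_lt_0_compat.
      split; [left; apply Rmult_lt_0_compat; apply exp_pos|].
      replace (gam - alpha * mu) with (gam + alpha * - mu) by ring.
      rewrite Rpower_plus, <- Rpower_mult.
      replace (Rpower x (- mu) * (Rpower t gam * Rpower (Rpower t alpha) (- mu)))
        with (Rpower t gam * (Rpower x (- mu) * Rpower (Rpower t alpha) (- mu))) by ring.
      rewrite Rpower_mult_distr by easy.
      apply Rmult_le_compat_l; [left; apply exp_pos|].
      rewrite !Rpower_Ropp; apply Rinv_le_contravar; [apply exp_pos|].
      apply Rle_Rpower_l; lra.
    + apply is_lim_seq_const.
    + replace (Finite 0) with (Rbar_mult (Rpower x (- mu)) 0)
        by (simpl; f_equal; ring).
      apply is_lim_seq_scal_l, is_lim_seq_Rpower_neg; lra.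
Qed.

(** Passing from [n] to [n + 1] subtracts [c_n x^n t^(gam + alpha n)] under the Euler sum, hence
    [c_n x^n] times [alt_zeta] at [- alpha n - gam]. Each difference remains real. *)
Lemma euler_sum_alt_g_rest a gam alpha mu (x : posreal) N :
  0 < a -> 0 < mu -> gam < alpha * mu ->
  exists l : R,
    (RtoC (alt_g x a gam alpha mu) -
     sum_n (G := C_AbelianMonoid) (fun k =>
       RtoC ((-1) ^ k / INR (fact k) * (Gamma (mu + INR k) / Gamma mu))
       * alt_zeta a (RtoC (- alpha * INR k - gam)) * RtoC (x ^ k))%C N)%C = RtoC l /\
    euler_sum (fun k => Rpower (INR k + a) gam
                        * binom_rest (S N) mu (x * Rpower (INR k + a) alpha)) l.
Proof.
  intros ha hmu hgam.
  assert (step : forall n l,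
    euler_sum (fun k => Rpower (INR k + a) gam
                        * binom_rest n mu (x * Rpower (INR k + a) alpha)) l ->
    exists l' : R,
      (RtoC l - RtoC ((-1) ^ n / INR (fact n) * (Gamma (mu + INR n) / Gamma mu))
       * alt_zeta a (RtoC (- alpha * INR n - gam)) * RtoC (x ^ n))%C = RtoC l' /\
      euler_sum (fun k => Rpower (INR k + a) gam
                          * binom_rest (S n) mu (x * Rpower (INR k + a) alpha)) l').
  { intros n l Hl.
    destruct (euler_sum_alt_zeta a (- alpha * INR n - gam) ha) as [v [Ev Hv]].
    exists (l - binom_coef mu n * x ^ n * v); split.
    - rewrite Ev, Gamma_rising by easy; fold (binom_coef mu n).
      rewrite <- !RtoC_mult, <- RtoC_minus; f_equal; ring.
    - refine (euler_sum_ext _ _ _ _ (euler_sum_minus _ _ _ _ Hl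
        (euler_sum_scal (binom_coef mu n * x ^ n) _ _ Hv))).
      intros k; cbn [binom_rest]; set (t := INR k + a).
      replace (- (- alpha * INR n - gam)) with (gam + alpha * INR n) by ring.
      rewrite Rpower_plus, <- Rpower_mult, Rpower_pow by apply exp_pos.
      rewrite Rpow_mult_distr; ring. }
  induction N as [|N [l [El Hl]]].
  - rewrite sum_O.
    apply (step O), euler_sum_alt_g; easy.
  - destruct (step (S N) l Hl) as [l' [El' Hl']].
    exists l'; split; [|easy].
    rewrite <- El', <- El, sum_Sn; unfold plus; simpl; ring.
Qed.

Theorem theorem1p4 (a gam alpha mu : R)
  (ha : 0 < a) (halpha : 0 < alpha) (hmu : Rmax (gam / alpha) 0 < mu) :
  asymp_expansion
    (fun x : R => RtoC (alt_g x a gam alpha mu))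
    (fun k : nat =>
       (RtoC ((-1) ^ k / INR (fact k) * (Gamma (mu + INR k) / Gamma mu))
        * alt_zeta a (RtoC (- alpha * INR k - gam)))%C).
Proof.
  assert (hmu0 : 0 < mu) by (eapply Rle_lt_trans; [apply Rmax_r|exact hmu]).
  assert (hgam : gam < alpha * mu).
  { rewrite Rmult_comm; apply Rlt_div_l; [easy|].
    eapply Rle_lt_trans; [apply Rmax_l|exact hmu]. }
  intros N eps.
  destruct (euler_sum_binom_rest a gam alpha mu (S N) ha hmu0) as [l [B Hl]].
  assert (hB : 0 < Rabs B + 1) by (pose proof (Rabs_pos B); lra).
  (* The bound [B x^(N+1)] is at most [eps x^N] once [x (|B| + 1) < eps]; the [+ 1] avoids a zero
     denominator. *)
  assert (he : 0 < eps / (Rabs B + 1))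
    by (apply Rdiv_lt_0_compat; [apply cond_pos|easy]).
  exists (mkposreal _ he); intros x Hx hx.
  change (Rabs (x - 0) < eps / (Rabs B + 1)) in Hx.
  apply Rabs_def2 in Hx; destruct Hx as [Hx _].
  rewrite Rminus_0_r in Hx; apply Rlt_div_r in Hx; [|easy].
  destruct (euler_sum_alt_g_rest a gam alpha mu (mkposreal x hx) N ha hmu0 hgam)
    as [v [Ev Hv]].
  destruct (Hl (mkposreal x hx)) as [Sl Bl].
  (* The error of the expansion and the bounded [l x] are Euler sums of the same sequence, hence
     equal. *)
  rewrite <- (euler_sum_unique _ _ _ Hv Sl) in Bl.
  simpl pos in Ev, Bl; rewrite Ev.
  change (norm (RtoC v)) with (Cmod (RtoC v)); rewrite Cmod_R.
  change (norm (x ^ N)) with (Rabs (x ^ N)).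
  pose proof (pow_lt x N hx) as hp.
  rewrite (Rabs_pos_eq (x ^ N)) by lra.
  eapply Rle_trans; [exact Bl|].
  replace (B * x ^ S N) with (B * x * x ^ N) by (simpl; ring).
  apply Rmult_le_compat_r; [lra|].
  pose proof (Rle_abs B); nra.
Qed.
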